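(* Consider the wideband multiple-antenna system described in the context, with $n_\mathrm{t}$ transmit and $n_\mathrm{r}$ receive antennas, i.i.d. fading matrices $\mathbf{H}_k\in\mathbb{C}^{n_\mathrm{r}\times n_\mathrm{t}}$ such that $\mathbf{V}_k:=\mathrm{vec}(\mathbf{H}_k^\dagger)\sim\mathcal{CN}(\mathbf{0},\mathbf{\Psi})$, and input covariance matrix $(\rho/K)\mathbf{\Sigma}$ on each parallel channel. Then the wideband minimum energy per nat is $$\bar{\eta}=\frac{1}{\mathrm{tr}\left((\mathbf{I}_{n_\mathrm{r}\times n_\mathrm{r}}\otimes\mathbf{\Sigma})\mathbf{\Psi}\right)},$$ and for every $\eta\ge\bar{\eta}$ the wideband outage exponent is $$\mathcal{E}(\eta)=\sup_{\lambda\le 0}\left\{\frac{\lambda}{\eta}+\log\det\left(\mathbf{I}-\lambda(\mathbf{I}_{n_\mathrm{r}\times n_\mathrm{r}}\otimes\mathbf{\Sigma})\mathbf{\Psi}\right)\right\},$$ where $\otimes$ denotes the Kronecker product.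
   Context: Setting. There are $K$ parallel channels; the $k$-th is $\mathbf{Y}_k=\mathbf{H}_k\mathbf{X}_k+\mathbf{Z}_k$ with noise $\mathbf{Z}_k\sim\mathcal{CN}(\mathbf{0},\mathbf{I}_{n_\mathrm{r}\times n_\mathrm{r}})$ and input $\mathbf{X}_k\sim\mathcal{CN}(\mathbf{0},(\rho/K)\mathbf{\Sigma})$, where $\rho>0$ is the total power and $\mathbf{\Sigma}\in\mathbb{R}^{n_\mathrm{t}\times n_\mathrm{t}}$ is symmetric positive semi-definite with $\mathrm{tr}\,\mathbf{\Sigma}=1$. The fading matrices $\mathbf{H}_1,\ldots,\mathbf{H}_K$ are i.i.d., with distribution not depending on $K$; $\mathbf{\Psi}\in\mathbb{R}^{n_\mathrm{t}n_\mathrm{r}\times n_\mathrm{t}n_\mathrm{r}}$ is symmetric positive semi-definite. Here $\dagger$ is conjugate transpose, $\mathrm{vec}$ stacks the columns of a matrix into a vector, and $\mathcal{CN}(\mathbf{0},\mathbf{C})$ is the circular-symmetric complex Gaussian law with covariance $\mathbf{E}[\mathbf{v}\mathbf{v}^\dagger]=\mathbf{C}$. The total achievable rate (in nats) is the random variable $$R(K,\rho)=\sum_{k=1}^K\log\det\left(\mathbf{I}_{n_\mathrm{r}\times n_\mathrm{r}}+\frac{\rho}{K}\mathbf{H}_k\mathbf{\Sigma}\mathbf{H}_k^\dagger\right).$$ The wideband minimum energy per nat $\bar\eta$ is the deterministic limit in probability of $\rho/R(K,\rho)$ as $K\to\infty$. For an energy per nat $\eta>0$, with target rate $r=\rho/\eta$,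 the wideband outage exponent is $$\mathcal{E}(\eta):=\lim_{K\to\infty}\frac{-\log\Pr[R(K,\rho)\le r]}{K}.$$ All logarithms are natural. *)

(* Defs.v *)
From HB Require Import structures.
From mathcomp Require Import all_boot all_order all_algebra.
From mathcomp Require Import finmap.
From mathcomp Require Import mxtens complex.
From mathcomp Require Import all_classical all_reals all_analysis.

Set Implicit Arguments.
Unset Strict Implicit.
Unset Printing Implicit Defensive.

Import Order.TTheory GRing.Theory Num.Theory numFieldNormedType.Exports.

Local Open Scope classical_set_scope.
Local Open Scope ring_scope.

Definition symmetric_psd (R : realType) (n : nat) (A : 'M[R]_n) : Prop :=
  A^T = A /\ forall x : 'cV[R]_n, 0 <= (x^T *m A *m x) 0 0.

Definition complexify (R : realType) (m n : nat) (A : 'M[R]_(m, n)) :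
  'M[R[i]]_(m, n) := map_mx (real_complex R) A.

Definition adjointmx (R : realType) (m n : nat) (A : 'M[R[i]]_(m, n)) :
  'M[R[i]]_(n, m) := (map_mx (@conjc R) A)^T.

(* [mxvec] concatenates rows, so it is applied to the transpose in order to
   stack columns; the coordinate of [A i j] is [j * m + i]. *)
Definition vec (F : Type) (m n : nat) (A : 'M[F]_(m, n)) : 'cV[F]_(n * m) :=
  (mxvec A^T)^T.

(* The Borel sigma-algebra of C^(m x n), generated by the real and imaginary
   parts of the entries. *)
Definition cmx_measurable (R : realType) (m n : nat) :
    set (set 'M[R[i]]_(m, n)) :=
  <<s [set B | exists (i : 'I_m) (j : 'I_n) (D : set R), measurable D /\
        (B = [set M : 'M[R[i]]_(m, n) | D (complex.Re (M i j))] \/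
         B = [set M : 'M[R[i]]_(m, n) | D (complex.Im (M i j))])] >>.

Section Probability.
Context (R : realType) (d : measure_display) (T : measurableType d).
Variable P : probability T R.

Definition random_cmx (m n : nat) (H : T -> 'M[R[i]]_(m, n)) : Prop :=
  forall B, cmx_measurable B -> measurable (H @^-1` B).

Definition mutually_independent (m n : nat)
    (H : nat -> T -> 'M[R[i]]_(m, n)) : Prop :=
  forall (J : {fset nat}) (B : nat -> set 'M[R[i]]_(m, n)),
    (forall k, k \in J -> cmx_measurable (B k)) ->
    P (\bigcap_(k in [set` J]) (H k @^-1` B k)) =
    (\prod_(k <- J) P (H k @^-1` B k))%E.

Definition identically_distributed (m n : nat)
    (H : nat -> T -> 'M[R[i]]_(m, n)) : Prop :=
  forall (k l : nat) (B : set 'M[R[i]]_(m, n)), cmx_measurable B ->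
    P (H k @^-1` B) = P (H l @^-1` B).

Definition iid (m n : nat) (H : nat -> T -> 'M[R[i]]_(m, n)) : Prop :=
  [/\ forall k, random_cmx (H k),
      mutually_independent H &
      identically_distributed H].

(* The law N(0, v); [normal_prob] takes the standard deviation, and is not the
   point mass when that is zero. *)
Definition centered_normal (v : R) (D : set R) : \bar R :=
  if v == 0 then \d_(0 : R) D else normal_prob 0 (Num.sqrt v) D.

(* X ~ N(0, S), with S possibly singular: every linear functional u^T X has
   the law N(0, u^T S u). *)
Definition normal_vector (n : nat) (X : T -> 'cV[R]_n) (S : 'M[R]_n) : Prop :=
  forall u : 'cV[R]_n,
    measurable_fun setT (fun w => (u^T *m X w) 0 0) /\
    forall D : set R, measurable D ->
      P [set w | D ((u^T *m X w) 0 0)] =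
      centered_normal ((u^T *m S *m u) 0 0) D.

(* V ~ CN(0, C): (Re V, Im V) is jointly Gaussian, and its covariance is the
   one equivalent to E[V V^dagger] = C and E[V V^T] = 0 (circular symmetry). *)
Definition complex_normal (n : nat) (V : T -> 'cV[R[i]]_n)
    (C : 'M[R[i]]_n) : Prop :=
  let ReC := map_mx (@complex.Re R) C in
  let ImC := map_mx (@complex.Im R) C in
  normal_vector
    (fun w => col_mx (map_mx (@complex.Re R) (V w))
                     (map_mx (@complex.Im R) (V w)))
    (2^-1 *: block_mx ReC (- ImC) ImC ReC).

(* Convergence in probability to a constant that may be infinite. *)
Definition cvg_in_probability (X : nat -> T -> \bar R) (l : \bar R) : Prop :=
  forall U : set (\bar R), open_nbhs l U ->
    P [set w | ~ U (X K w)] @[K --> \oo] --> 0%E.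

Section Wideband.
Variables (nr nt : nat) (H : nat -> T -> 'M[R[i]]_(nr, nt)).
Variables (Sigma : 'M[R]_nt) (rho : R).

(* Channels are numbered from 0; the determinant is real, so [complex.Re] only
   changes its type. *)
Definition rate (K : nat) (w : T) : R :=
  \sum_(k < K)
    ln (complex.Re (\det (1%:M + real_complex R (rho / K%:R) *:
          (H k w *m complexify Sigma *m adjointmx (H k w))))).

(* In [\bar R] the inverse of 0 is [+oo], so that [rho / rate] is [+oo] when
   the rate is zero. *)
Definition wideband_min_energy_per_nat (etabar : \bar R) : Prop :=
  cvg_in_probability (fun K w => rho%:E / (rate K w)%:E)%E etabar.

Definition wideband_outage_exponent (eta : R) (e : \bar R) : Prop :=
  (- lne (P [set w | (rate K w <= rho / eta)%R]) / (K%:R)%:E)%E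
    @[K --> \oo] --> e.

End Wideband.
End Probability.

(* Main.v *)
(* The received energy of a channel, tr(H Sigma H^dag), is a Gaussian quadratic
   form: with A = (I (x) Sigma) Psi its Laplace transform at s >= 0 is
   1 / det(I + s A) = prod_i 1 / (1 + s alpha_i), the alpha_i >= 0 being the
   eigenvalues of A.  It is computed by writing the form as a sum of squares of
   real linear functionals and replacing each factor exp(-y^2/2) by the
   characteristic function of an auxiliary standard normal variable at y.

   Let S_K be the sum of the K energies and r_K the total rate.  The bound
   r_K <= (rho/K) S_K and the limit (K/rho) log det(I + (rho/K) H Sigma H^dag) ->
   tr(H Sigma H^dag) reduce both claims to the large deviations of S_K below its
   mean.  The upper bound is Chernoff's inequality for r_K, with dominated
   convergence for the single-channel factor.  The lower bound is Cramer's
   change of measure; all the quantities it involves (Chernoff bounds under the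
   tilted law included) are Laplace transforms of S_K at nonnegative points, so
   the tilted law itself is never constructed. *)
From HB Require Import structures.
Require Import Defs.
From mathcomp Require Import all_boot all_order all_algebra.
From mathcomp Require Import finmap.
From mathcomp Require Import mxtens complex.
From mathcomp Require Import ring lra.
From mathcomp Require Import all_classical all_reals all_analysis.
From mathcomp Require Import measurable_realfun.
Set Implicit Arguments.
Unset Strict Implicit.
Unset Printing Implicit Defensive.
Import Order.TTheory GRing.Theory Num.Theory numFieldNormedType.Exports.
Local Open Scope classical_set_scope.
Local Open Scope ring_scope.

(** * Spectra of products of positive semi-definite matrices *)

Section complex_spectra.
Local Open Scope complex_scope.

(** The Gaussian hypothesis gives the law of one real linear functional at a time, with a possibly
    singular covariance, so there is no joint density to integrate. Only functions of one functional
    can be integrated directly; cosines are chosen because the product-to-sum formula lets them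
    absorb further factors. Independence is likewise given for events, and the layer-cake formula
    carries it to expectations of products. [A] need not be symmetric, so its eigenvalues are taken
    from the complex characteristic polynomial. Once they form a nonnegative real list [al],
    everything concerns the concave function [L(s) = sum ln (1 + s x)]: its tangent inequality
    replaces differentiation, and the supremum over [lambda = - s] is attained where
    [L'(s) = 1 / eta]. Tilting exactly at that s would put the tilted mean on the boundary of the
    event, where Chernoff bounds give no decay; the tilt is therefore pushed slightly further. The
    trace may vanish: then [etabar] is [+oo] and no real [eta] lies above it. *)

Lemma nonneg_eigenvalues (R : realType) (n : nat) (A : 'M[R[i]]_n) :
  (forall (z : 'rV_n) (l : R[i]), z *m A = l *: z -> z != 0 -> 0 <= l) ->
  exists2 al : seq R, all (>= 0) al &
    (forall c : R, \det (1%:M + c%:C *: A) = (\prod_(x <- al) (1 + c * x))%:C)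
    /\ \tr A = (\sum_(x <- al) x)%:C.
Proof.
move=> hA.
have [rs Ers] := closed_field_poly_normal (char_poly A).
move: Ers; rewrite (monicP (char_poly_monic A)) scale1r => Ers.
have szrs : size rs = n.
  by have := size_char_poly A; rewrite Ers size_prod_XsubC => -[].
have rs0 : forall z, z \in rs -> 0 <= z.
  move=> z zrs; have : eigenvalue A z.
    by rewrite eigenvalue_root_char Ers root_prod_XsubC.
  by move=> /eigenvalueP[v vA v0]; exact: hA vA v0.
(* In the order on [R[i]] only real numbers are above 0, so each root is the image of its real
   part. *)
have Ers' : rs = map (real_complex R) (map (@complex.Re R) rs).
  rewrite -map_comp map_id_in// => z /rs0 z0 /=.
  by rewrite RRe_real// ger0_real.
exists (map (@complex.Re R) rs).
  by apply/allP => _ /mapP[z /rs0 + ->]; rewrite lecE => /andP[].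
set al := map _ rs in Ers' *; split=> [c|].
  have [->|c0] := eqVneq c 0.
    rewrite scale0r addr0 det1 big1_seq ?rmorph1// => x _.
    by rewrite mul0r addr0.
  have cC0 : c%:C != 0 by rewrite fmorph_eq0.
  (* The determinant becomes [(- c)^n] times the characteristic polynomial at [- 1 / c], which
     splits over the roots. *)
  have -> : 1%:M + c%:C *: A = (- c%:C) *: ((- c%:C^-1)%:M - A).
    rewrite scalerBr scale_scalar_mx mulrNN divff//.
    by rewrite scaleNr opprK.
  rewrite detZ.
  have -> : \det ((- c%:C^-1)%:M - A) = (char_poly A).[- c%:C^-1].
    rewrite /char_poly -[RHS]horner_evalE -det_map_mx; congr (\det _).
    by apply/matrixP => i j; rewrite !mxE /= /horner_eval !(hornerE, hornerMn).
  rewrite Ers horner_prod rmorph_prod/= -szrs Ers' size_map big_map.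
  elim: al {Ers'} => [|x al IH]; first by rewrite !big_nil expr0 mulr1.
  rewrite !big_cons/= exprS mulrACA IH; congr (_ * _).
  rewrite !hornerE rmorphD rmorph1 rmorphM/=; field.
  by [].
have [n0|n0] := posnP n.
  have al0 : al = [::] by apply: size0nil; rewrite size_map szrs.
  rewrite al0 big_nil /mxtrace big1// => i _; have := ltn_ord i.
  by rewrite [X in (_ < X)%N]n0.
have := @coefPn_prod_XsubC _ rs; rewrite szrs -lt0n n0 -Ers char_poly_trace//.
by move=> /(_ isT)/oppr_inj ->; rewrite rmorph_sum/= [in LHS]Ers' big_map.
Qed.

End complex_spectra.

Section psd.
Context (R : realType) (n : nat).
Implicit Types (S : 'M[R]_n) (x y u w : 'cV[R]_n).

Definition bil S x y : R := (x^T *m S *m y) 0 0.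

Lemma bilDl S x1 x2 y : bil S (x1 + x2) y = bil S x1 y + bil S x2 y.
Proof. by rewrite /bil linearD/= !mulmxDl mxE. Qed.

Lemma bilDr S x y1 y2 : bil S x (y1 + y2) = bil S x y1 + bil S x y2.
Proof. by rewrite /bil mulmxDr mxE. Qed.

Lemma bilZl S a x y : bil S (a *: x) y = a * bil S x y.
Proof. by rewrite /bil linearZ/= -!scalemxAl mxE. Qed.

Lemma bilZr S a x y : bil S x (a *: y) = a * bil S x y.
Proof. by rewrite /bil -!scalemxAr mxE. Qed.

Lemma bilC S x y : S^T = S -> bil S x y = bil S y x.
Proof.
move=> SS; have -> : bil S x y = (x^T *m S *m y)^T 0 0 by rewrite mxE.
by rewrite !trmx_mul SS trmxK mulmxA.
Qed.

Lemma bil_delta S i j : bil S (delta_mx i 0) (delta_mx j 0) = S i j.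
Proof. by rewrite /bil trmx_delta -rowE -colE !mxE. Qed.

Lemma bil_rank1 S u x y :
  bil (S *m u *m (u^T *m S)) x y = bil S x u * bil S u y.
Proof.
rewrite /bil (_ : _ *m y = (x^T *m S *m u) *m (u^T *m S *m y)).
  by rewrite mxE big_ord1.
by rewrite !mulmxA.
Qed.

(** For [c = 0] this is a step of Cholesky elimination; for [c = 1] it is the Sherman-Morrison
    formula for [S (1 + u u^T S)^-1]. Both uses occur below. *)
Definition downdate (c : R) S u : 'M[R]_n :=
  S - (c + bil S u u)^-1 *: (S *m u *m (u^T *m S)).

Lemma bil_downdate c S u x y : bil (downdate c S u) x y =
  bil S x y - bil S x u * bil S u y / (c + bil S u u).
Proof.
rewrite {1}/bil mulmxBr mulmxBl -scalemxAr -scalemxAl.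
rewrite [LHS]mxE [X in _ + X]mxE [X in - X]mxE.
by rewrite -/(bil _ x y) -/(bil (_ *m _) x y) bil_rank1 mulrC.
Qed.

(** Completing the square: with [t = bil S u w / (c + bil S u u)], the new form at [w] is the old
    form at [w - t u] plus [c t^2]. *)
Lemma symmetric_psd_downdate c S u : symmetric_psd S -> 0 <= c ->
  0 < c + bil S u u -> symmetric_psd (downdate c S u).
Proof.
move=> [SS S0] c0 cu0; split.
  by rewrite linearB/= linearZ/= !trmx_mul trmxK SS.
move=> w; rewrite -/(bil _ w w) bil_downdate.
set d := c + _ in cu0 *; set t := bil S u w / d.
have := S0 (w - t *: u); rewrite -/(bil S _ _) -scaleNr.
rewrite !bilDl !bilDr !bilZl !bilZr (bilC w u SS) => h.
have := mulr_ge0 c0 (sqr_ge0 t).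
have tE : bil S u w = t * d by rewrite /t divfK// gt_eqF.
have uE : bil S u u = d - c by rewrite /d; ring.
rewrite (_ : _ * _ / d = t ^+ 2 * d); last by rewrite tE; field; rewrite gt_eqF.
by move: h; rewrite tE uE; nra.
Qed.

(** Cholesky elimination, by induction on the number of nonzero diagonal entries. Eliminating along
    a unit vector clears its diagonal entry, and zero entries stay zero because they can neither
    increase nor become negative. When the whole diagonal vanishes, the form at [e_i + e_j] and
    [e_i - e_j] forces the matrix to be 0. *)
Lemma psd_sum_rank1 S : symmetric_psd S ->
  exists us : seq 'cV[R]_n, S = \sum_(u <- us) u *m u^T.
Proof.
have [k] := ubnP #|[pred i | S i i != 0]|.
elim: k S => // k IH S; rewrite ltnS => Sk psdS; have [SS S0] := psdS.
have S0' x : 0 <= bil S x x by exact: S0.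
have SC i j : S i j = S j i by rewrite -[in LHS]SS mxE.
have [[i Si]|] := pselect (exists i, S i i != 0); last first.
  move=> /forallNP nS; exists [::]; rewrite big_nil.
  have {}nS i : S i i = 0 by apply/eqP/negPn/negP; exact: nS.
  apply/matrixP => i j; rewrite mxE.
  have := S0' (delta_mx i 0 + delta_mx j 0).
  have := S0' (delta_mx i 0 + (-1) *: delta_mx j 0).
  rewrite !bilDl !bilDr !bilZl !bilZr !bil_delta !nS.
  rewrite (SC j i); lra.
have Si0 : 0 < S i i.
  by rewrite lt_neqAle eq_sym Si/= -bil_delta.
pose e : 'cV[R]_n := delta_mx i 0.
have eE : bil S e e = S i i by rewrite bil_delta.
have psdD : symmetric_psd (downdate 0 S e).
  by apply: symmetric_psd_downdate => //; rewrite add0r eE.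
have DE j : downdate 0 S e j j = S j j - S j i ^+ 2 / S i i.
  rewrite -[LHS]bil_delta bil_downdate eE add0r !bil_delta.
  by rewrite SC expr2.
have [|us Eus] := IH _ _ psdD.
  apply: leq_trans Sk; apply: proper_card; apply/properP; split.
    apply/fintype.subsetP => j; rewrite !inE; apply: contra => /eqP Sj.
    have := psdD.2 (delta_mx j 0); rewrite -/(bil _ _ _) bil_delta DE Sj add0r.
    rewrite oppr_ge0 => h; apply/eqP; apply: le_anti.
    by rewrite oppr_ge0 oppr_le0 h divr_ge0// ?sqr_ge0// ltW.
  by exists i; rewrite !inE// DE expr2 mulfK// subrr eqxx.
exists ((Num.sqrt (S i i))^-1 *: (S *m e) :: us).
rewrite big_cons -Eus /downdate add0r eE.
rewrite linearZ/= -scalemxAl -scalemxAr scalerA trmx_mul SS.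
by rewrite -invfM -expr2 sqr_sqrtr ?(ltW Si0)// addrC subrK.
Qed.

End psd.

Section spectra.
Context (R : realType).
Local Open Scope complex_scope.

Lemma adjointmx_mul m n p (A : 'M[R[i]]_(m, n)) (B : 'M[R[i]]_(n, p)) :
  adjointmx (A *m B) = adjointmx B *m adjointmx A.
Proof. by rewrite /adjointmx map_mxM trmx_mul. Qed.

Lemma adjointmx_real m n (A : 'M[R]_(m, n)) :
  adjointmx (map_mx (real_complex R) A) = map_mx (real_complex R) A^T.
Proof. by apply/matrixP => i j; rewrite !mxE conjc_real. Qed.

Lemma mul_adjointmx_ge0 n (z : 'rV[R[i]]_n) : 0 <= (z *m adjointmx z) 0 0.
Proof. by rewrite mxE sumr_ge0// => i _; rewrite !mxE mulcJ_ge0. Qed.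

Lemma mul_adjointmx_eq0 n (z : 'rV[R[i]]_n) :
  (z *m adjointmx z) 0 0 = 0 -> z = 0.
Proof.
rewrite mxE => /psumr_eq0P h; apply/rowP => i; rewrite mxE.
have /eqP : z 0 i * adjointmx z i 0 = 0.
  by apply: h => // j _; rewrite !mxE mulcJ_ge0.
by rewrite !mxE mulf_eq0 conjc_eq0 orbb => /eqP.
Qed.

(** An eigenvalue is the quotient of [z (h S h^dag) z^dag] by [z z^dag]; writing [S] as a sum of
    [u u^T] makes the numerator a sum of squared moduli. *)
Lemma trace_det_ge0 m n (h : 'M[R[i]]_(m, n)) (S : 'M[R]_n) :
  symmetric_psd S ->
  exists2 al : seq R, all (>= 0) al &
    (forall c : R, \det (1%:M + c%:C *:
        (h *m complexify S *m adjointmx h)) = (\prod_(x <- al) (1 + c * x))%:C)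
    /\ \tr (h *m complexify S *m adjointmx h) = (\sum_(x <- al) x)%:C.
Proof.
move=> /psd_sum_rank1[us SE]; apply: nonneg_eigenvalues => z l zl z0.
have zz0 : 0 < (z *m adjointmx z) 0 0.
  rewrite lt_neqAle mul_adjointmx_ge0 andbT eq_sym.
  by apply: contra_neq z0; exact: mul_adjointmx_eq0.
have : (z *m (h *m complexify S *m adjointmx h) *m adjointmx z) 0 0 =
       l * (z *m adjointmx z) 0 0 by rewrite zl -scalemxAl mxE.
have -> : z *m (h *m complexify S *m adjointmx h) *m adjointmx z =
    \sum_(u <- us) (z *m h *m complexify u) *m adjointmx (z *m h *m complexify u).
  rewrite SE /complexify raddf_sum mulmx_sumr !mulmx_suml mulmx_sumr mulmx_suml.
  apply: eq_bigr => u _; by rewrite /= map_mxM !adjointmx_mul adjointmx_real !mulmxA.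
move=> /(congr1 (fun x => x / (z *m adjointmx z) 0 0)).
rewrite mulfK ?gt_eqF// => <-; rewrite divr_ge0 ?(ltW zz0)// summxE.
by apply: sumr_ge0 => u _; exact: mul_adjointmx_ge0.
Qed.

(* An eigenvector z of B Psi satisfies l (z B z^dag) = (z B) Psi (z B)^dag, and
   z B = 0 as soon as z B z^dag = 0. *)
Lemma psd_mul_spectrum n (B Psi : 'M[R]_n) :
  symmetric_psd B -> symmetric_psd Psi ->
  exists2 al : seq R, all (>= 0) al &
    (forall c : R, \det (1%:M + c *: (B *m Psi)) = \prod_(x <- al) (1 + c * x))
    /\ \tr (B *m Psi) = \sum_(x <- al) x.
Proof.
move=> /psd_sum_rank1[us BE] /psd_sum_rank1[vs PE].
pose CB := complexify B; pose CP := complexify Psi.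
have quad (ws : seq 'cV[R]_n) (z : 'rV[R[i]]_n) :
    z *m complexify (\sum_(w <- ws) w *m w^T) *m adjointmx z =
    \sum_(w <- ws) (z *m complexify w) *m adjointmx (z *m complexify w).
  rewrite /complexify raddf_sum mulmx_sumr mulmx_suml.
  apply: eq_bigr => u _; by rewrite /= map_mxM !adjointmx_mul adjointmx_real !mulmxA.
have quad0 (ws : seq 'cV[R]_n) (z : 'rV[R[i]]_n) : 0 <= (z *m complexify (\sum_(w <- ws) w *m w^T)
    *m adjointmx z) 0 0.
  rewrite quad summxE; apply: sumr_ge0 => u _; exact: mul_adjointmx_ge0.
have adjB : adjointmx CB = CB.
  rewrite /CB BE; apply/matrixP => i j; rewrite !mxE conjc_real.
  congr (real_complex R _); rewrite !summxE; apply: eq_bigr => u _.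
  by rewrite !mxE !big_ord1 !mxE mulrC.
have [|al al0 [ald alt]] := @nonneg_eigenvalues R n (complexify (B *m Psi)).
  move=> z l; rewrite /complexify map_mxM mulmxA -/CB -/CP => zl z0.
  have : (z *m CB *m CP *m adjointmx (z *m CB)) 0 0 =
      l * (z *m CB *m adjointmx z) 0 0.
    by rewrite zl adjointmx_mul adjB mulmxA -!scalemxAl mxE.
  have [zBz|] := eqVneq ((z *m CB *m adjointmx z) 0 0) 0.
    have zB : z *m CB = 0.
      move: zBz; rewrite /CB BE quad summxE => /eqP.
      rewrite psumr_eq0; last by move=> u _; exact: mul_adjointmx_ge0.
      move=> /allP zu; rewrite /complexify raddf_sum mulmx_sumr big1_seq//= => u us_u.
      move/zu : us_u => /eqP/mul_adjointmx_eq0 zu0.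
      by rewrite map_mxM mulmxA zu0 mul0mx.
    move: zl; rewrite zB mul0mx => /esym/eqP; rewrite scaler_eq0 (negPf z0) orbF.
    by move=> /eqP -> _.
  move=> zBz0 /(congr1 (fun x => x / (z *m CB *m adjointmx z) 0 0)).
  rewrite mulfK// => <-; rewrite divr_ge0//.
    by rewrite /CP PE quad0.
  by rewrite /CB BE quad0.
exists al => //; split=> [c|].
  apply: (@complexI R); rewrite -ald -det_map_mx; congr (\det _).
  apply/matrixP => i j; rewrite !mxE rmorphD rmorphM/= rmorphMn/=.
  by rewrite rmorph1.
by apply: (@complexI R); rewrite -alt -trace_map_mx.
Qed.

End spectra.

(** * Kronecker indices, and the received energy as a sum of squares *)

Lemma index_allpairs (S T : eqType) (s : seq S) (t : seq T) x y :
  x \in s -> y \in t ->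
  index (x, y) [seq (a, b) | a <- s, b <- t] = (index x s * size t + index y t)%N.
Proof.
move=> + yt; elim: s => // a s IH; rewrite inE allpairs_cons index_cat.
have [<- _|xa /= xs] := eqVneq a x.
  rewrite map_f// /= eqxx mul0n add0n index_map//.
  by move=> ? ? [].
case: ifPn => [/mapP[b _ [xa']]|_]; first by rewrite xa' eqxx in xa.
by rewrite (negPf xa) size_map IH// mulSn addnA.
Qed.

(** [vec] is indexed by the rank of a pair in an enumeration, the Kronecker product by an arithmetic
    formula; both are [i * n + j]. *)
Lemma mxvec_indexE (m n : nat) (i : 'I_m) (j : 'I_n) :
  mxvec_index i j = mxtens_index (i, j).
Proof.
apply: val_inj => /=; rewrite /enum_rank enum_rank_in.unlock /insubd.
rewrite insubT /=.
  by rewrite cardE index_mem mem_enum.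
move=> _.
rewrite enumT unlock /= index_allpairs ?mem_enum//.
by rewrite !index_enum_ord size_enum_ord.
Qed.

Section received_energy.
Local Open Scope complex_scope.
Context (R : realType) (nr nt : nat).
Implicit Types (h : 'M[R[i]]_(nr, nt)) (S : 'M[R]_nt).

Definition reim_vec (n : nat) (v : 'cV[R[i]]_n) : 'cV[R]_(n + n) :=
  col_mx (map_mx (@complex.Re R) v) (map_mx (@complex.Im R) v).

(** The Kronecker product of the j-th unit vector with [u]. *)
Definition kron_delta (j : 'I_nr) (u : 'cV[R]_nt) : 'cV[R]_(nr * nt) :=
  \col_k (((mxtens_unindex k).1 == j)%:R * u (mxtens_unindex k).2 0).

Lemma sum_mxtens (F : 'I_(nr * nt) -> R) :
  \sum_k F k = \sum_(i < nr) \sum_(j < nt) F (mxtens_index (i, j)).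
Proof.
rewrite pair_bigA/= (reindex (@mxtens_index nr nt))/=.
  by apply: eq_bigr => -[].
exists (@mxtens_unindex nr nt) => x _; [exact: mxtens_indexK|exact: mxtens_unindexK].
Qed.

Lemma kron_delta_mul (j : 'I_nr) (u : 'cV[R]_nt) (w : 'cV[R]_(nr * nt)) :
  ((kron_delta j u)^T *m w) 0 0 = \sum_(i < nt) u i 0 * w (mxtens_index (j, i)) 0.
Proof.
rewrite mxE sum_mxtens (bigD1 j)//= [X in _ + X]big1 ?addr0.
  apply: eq_bigr => i _.
  by rewrite !mxE mxtens_indexK/= eqxx mul1r.
move=> k kj; apply: big1 => i _.
by rewrite !mxE mxtens_indexK/= (negPf kj) !mul0r.
Qed.

(** When [Sigma] is the sum of the [u u^T], the energy is the sum over j and [u] of the squared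
    modulus of [(h u)_j]. Its real and imaginary parts are, up to sign, the functionals of
    [(Re V, Im V)] given by these two families, where [V] is [vec (adjointmx h)]. *)
Definition energy_vectors (us : seq 'cV[R]_nt) : seq 'cV[R]_(nr * nt + nr * nt) :=
  [seq col_mx (kron_delta j u) 0 | j <- enum 'I_nr, u <- us] ++
  [seq col_mx 0 (kron_delta j u) | j <- enum 'I_nr, u <- us].

Lemma energy_vectors_cov us :
  \sum_(v <- energy_vectors us) v *m v^T =
  let B := tensmx (1%:M : 'M[R]_nr) (\sum_(u <- us) u *m u^T) in
  block_mx B 0 0 B.
Proof.
set B := tensmx _ _.
have BE : \sum_(j <- enum 'I_nr) \sum_(u <- us)
    kron_delta j u *m (kron_delta j u)^T = B. 
  apply/matrixP => k l; rewrite big_enum/= summxE.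
  case: (mxtens_indexP k) => i1 i2; case: (mxtens_indexP l) => k1 k2.
  rewrite /B tensmxE [in RHS]summxE !mxE mulr_sumr (bigD1 i1)//= [X in _ + X]big1.
    rewrite addr0 summxE; apply: eq_bigr => u _.
    by rewrite !mxE !big_ord1 !mxE !mxtens_indexK/= eqxx mul1r eq_sym mulrCA.
  move=> j ji; rewrite summxE big1// => u _.
  by rewrite mxE big_ord1 !mxE mxtens_indexK/= eq_sym (negPf ji) !mul0r.
rewrite /= big_cat !big_allpairs_dep/=.
under eq_bigr => j _ do under eq_bigr => u _ do
  rewrite tr_col_mx mul_col_row trmx0 !mul0mx mulmx0.
under [X in _ + X]eq_bigr => j _ do under eq_bigr => u _ do
  rewrite tr_col_mx mul_col_row trmx0 !mul0mx mulmx0.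
have blk (f g : 'I_nr -> 'cV[R]_nt -> 'M[R]_(nr * nt)) :
   \sum_(j <- enum 'I_nr) \sum_(u <- us) block_mx (f j u) 0 0 (g j u) =
   block_mx (\sum_(j <- enum 'I_nr) \sum_(u <- us) f j u) 0 0
            (\sum_(j <- enum 'I_nr) \sum_(u <- us) g j u).
  elim: (enum 'I_nr) => [|j s IH]; first by rewrite !big_nil block_mx_const.
  rewrite !big_cons IH; set X := \sum_(u <- us) _.
  have -> : X = block_mx (\sum_(u <- us) f j u) 0 0 (\sum_(u <- us) g j u).
    rewrite /X; elim: (us) => [|u t IHt]; first by rewrite !big_nil block_mx_const.
    by rewrite !big_cons IHt add_block_mx !addr0.
  by rewrite add_block_mx !addr0.
rewrite (blk _ (fun _ _ => 0)) (blk (fun _ _ => 0)) add_block_mx BE !addr0.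
by do ! (rewrite big1; last by move=> ? _; rewrite big1//); rewrite addr0 add0r.
Qed.

Lemma energy_sum_sqr h us :
  complex.Re (\tr (h *m complexify (\sum_(u <- us) u *m u^T) *m adjointmx h)) =
  \sum_(v <- energy_vectors us) ((v^T *m reim_vec (vec (adjointmx h))) 0 0) ^+ 2.
Proof.
have ReD : {morph @complex.Re R : x y / x + y} by case=> ? ? [].
have ImD : {morph @complex.Im R : x y / x + y} by case=> ? ? [].
have vecE j i : vec (adjointmx h) (mxtens_index (j, i)) 0 = (h j i)^*.
  by rewrite /vec mxE -mxvec_indexE mxvecE !mxE.
rewrite /energy_vectors big_cat !big_allpairs_dep/= -big_split/= big_enum/=.
rewrite /mxtrace (big_morph _ ReD (erefl _)); apply: eq_bigr => j _.
rewrite -big_split/= /complexify raddf_sum mulmx_sumr mulmx_suml summxE/=.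
rewrite (big_morph _ ReD (erefl _)); apply: eq_bigr => u _.
rewrite /reim_vec !tr_col_mx !mul_row_col !trmx0 !mul0mx addr0 add0r.
rewrite !kron_delta_mul map_mxM/= mulmxA -mulmxA mxE big_ord1.
set c := (h *m _) j 0.
have -> : (map_mx (real_complex R) u^T *m adjointmx h) 0 j = c^*.
  rewrite /c !mxE rmorph_sum/=; apply: eq_bigr => i _.
  by rewrite !mxE rmorphM/= oppr0 mulrC.
have <- : complex.Re c = \sum_(i < nt) u i 0 *
    map_mx (@complex.Re R) (vec (adjointmx h)) (mxtens_index (j, i)) 0.
  rewrite /c mxE (big_morph _ ReD (erefl _)); apply: eq_bigr => i _.
  by rewrite [map_mx _ (vec _) _ _]mxE vecE !mxE; case: (h j i) => a b /=; ring.
(* The conjugation in [adjointmx] flips the sign of the imaginary part; squaring removes it. *)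
have -> : \sum_(i < nt) u i 0 *
    map_mx (@complex.Im R) (vec (adjointmx h)) (mxtens_index (j, i)) 0 =
    - complex.Im c.
  rewrite /c mxE (big_morph _ ImD (erefl _)) -sumrN; apply: eq_bigr => i _.
  by rewrite [map_mx _ (vec _) _ _]mxE vecE !mxE; case: (h j i) => a b /=; ring.
by case: c => a b /=; ring.
Qed.

End received_energy.

(** * One-dimensional Gaussian integrals *)

Section gaussian.
Context (R : realType).
Notation mu := (@lebesgue_measure R).

(** The fundamental theorem of calculus on [[- (n + 1), n + 1]], a nondegenerate interval for every
    n, followed by dominated convergence with bound [|f|]. *)
Lemma integral_derivative_eq0 (F f : R -> R) :
  (forall x, is_derive x (1 : R) F (f x)) -> continuous f ->
  mu.-integrable setT (EFin \o f) ->
  F n%:R @[n --> \oo] --> (0 : R) -> F (- n%:R) @[n --> \oo] --> (0 : R) ->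
  \int[mu]_x f x = 0.
Proof.
move=> dF cf intf Fy FNy.
have cF : continuous F.
  move=> x; apply/differentiable_continuous/derivable1_diffP.
  by case: (dF x).
have FTC n : (\int[mu]_(x in `[(- n.+1%:R)%R, n.+1%:R%R]) (f x)%:E =
    (F n.+1%:R)%:E - (F (- n.+1%:R))%:E)%E.
  apply: continuous_FTC2.
  - by rewrite ltrNl (lt_le_trans _ (ler0n _ n.+1))// oppr_lt0 ltr0Sn.
  - exact: continuous_subspaceT.
  - split.
    + by move=> x _; case: (dF x).
    + by apply: cvg_at_right_filter; exact: cF.
    + by apply: cvg_at_left_filter; exact: cF.
  - by move=> x _; rewrite derive1E; case: (dF x).
pose f_ n : R -> \bar R := (EFin \o f) \_ `[(- n.+1%:R)%R, n.+1%:R%R].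
have mf : measurable_fun [set: R] (EFin \o f).
  by apply/measurable_EFinP; exact: continuous_measurable_fun.
have cvf : (\int[mu]_x f_ n x)%E @[n --> \oo] --> (\int[mu]_x (f x)%:E)%E.
  have [] // := @dominated_convergence _ _ R mu setT measurableT f_
     (fun x => (f x)%:E) (fun x => `|f x|%:E) _ mf.
  - by move=> n; apply/(measurable_restrictT _ _).1 => //; apply: measurable_funS mf.
  - apply: aeW => x _; apply: cvg_near_cst.
    exists (Num.trunc `|x|) => // n /= xn.
    rewrite /f_ patchE mem_set//= in_itv/=.
    rewrite -ler_norml.
    rewrite ltW// (lt_le_trans (truncnS_gt _))//.
    by rewrite ler_nat ltnS.
  - exact: integrable_norm intf.
  - apply: aeW => x n _; rewrite /f_ patchE; case: ifP => _//=.
    by rewrite normr0 lee_fin.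
have cv0 : (\int[mu]_x f_ n x)%E @[n --> \oo] --> (0%R%:E : \bar R).
  rewrite (_ : (fun n => _) = (fun n => (F n.+1%:R - F (- n.+1%:R))%:E)).
    apply: cvg_EFin; first exact: nearW.
    rewrite -[X in _ --> X](subr0 0).
    apply: cvgB.
      by rewrite (cvg_shiftS (fun n => F n%:R)).
    by rewrite (cvg_shiftS (fun n => F (- n%:R))).
  by apply/funext => n; rewrite -integral_mkcond FTC.
by rewrite /Rintegral (cvg_unique _ cvf cv0).
Qed.

Variable s : R.
Hypothesis s_gt0 : 0 < s.
Let phi := normal_pdf 0 s.

Let s_neq0 : s != 0. Proof. by rewrite gt_eqF. Qed.

Let phiE x : phi x = normal_peak s * expR (- (x ^+ 2 / (s ^+ 2 *+ 2))).
Proof. by rewrite /phi normal_pdfE// /normal_fun subr0 mulNr. Qed.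

Let phi_ge0 x : 0 <= phi x. Proof. exact: normal_pdf_ge0. Qed.

Let cphi : continuous phi. Proof. exact: continuous_normal_pdf. Qed.

Let mphi : measurable_fun setT phi. Proof. exact: measurable_normal_pdf. Qed.

Let is_derive_phi x : is_derive x (1 : R) phi (- (x / s ^+ 2) * phi x).
Proof.
rewrite (_ : phi = fun x => normal_peak s * expR (- (x ^+ 2 / (s ^+ 2 *+ 2)))); last first.
  by apply/funext => y; rewrite phiE.
have h : is_derive x (1 : R) (fun x : R => - (x ^+ 2 / (s ^+ 2 *+ 2))) (- (x / s ^+ 2)).
  rewrite (_ : (fun x => _) = (- (s ^+ 2 *+ 2)^-1) \*: (fun x : R => x ^+ 2)); last first.
    by apply/funext => y /=; rewrite /GRing.scale/= mulNr mulrC.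
  apply: is_derive_eq; rewrite /GRing.scale/=.
  by rewrite -mulr_natr; field; rewrite ?s_neq0.
apply: (@is_derive_eq _ _ _ _ _ _ _ _ (is_deriveZ (normal_peak s) (is_derive1_comp _ h))).
rewrite /GRing.scale/=; ring.
Qed.

(** Half of the Gaussian exponent absorbs the factor [|x|]: with [u = x^2 / (4 s^2)],
    [|x| <= s (1 + u) <= s e^u]. The bound is again a normal density, which yields both
    integrability and decay. *)
Let norm_mul_phi x :
  `|x| * phi x <= s * (Num.sqrt 2 * normal_pdf 0 (s * Num.sqrt 2) x).
Proof.
rewrite phiE normal_pdfE; last by rewrite mulf_neq0// gt_eqF// sqrtr_gt0.
rewrite /normal_fun subr0 mulNr /normal_peak exprMn sqr_sqrtr//.
have -> : s ^+ 2 * 2 * pi *+ 2 = 2 * (s ^+ 2 * pi *+ 2).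
  by ring.
rewrite sqrtrM//; set S := Num.sqrt (s ^+ 2 * pi *+ 2); set r := Num.sqrt 2.
have r0 : r != 0 by rewrite gt_eqF// sqrtr_gt0.
have S0 : S != 0.
  by rewrite gt_eqF// sqrtr_gt0 pmulrn_lgt0// mulr_gt0 ?exprn_gt0// pi_gt0.
have -> z : s * (r * ((r * S)^-1 * z)) = S^-1 * (s * z) by field; rewrite r0 S0.
rewrite mulrCA.
apply: ler_wpM2l; first by rewrite invr_ge0 sqrtr_ge0.
set u := x ^+ 2 / (s ^+ 2 * 2 *+ 2).
have -> : x ^+ 2 / (s ^+ 2 *+ 2) = u + u.
  by rewrite /u; field.
rewrite opprD expRD mulrA ler_wpM2r ?expR_ge0//.
rewrite expRN ler_pdivrMr ?expR_gt0//.
apply: (@le_trans _ _ (s * (1 + u))); last first.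
  by rewrite ler_pM2l// expR_ge1Dx.
rewrite -subr_ge0.
have -> : s * (1 + u) - `|x| = s * (`|x| / (2 * s) - 1) ^+ 2.
  have -> : u = `|x| ^+ 2 / (s ^+ 2 * 2 * 2).
    by rewrite real_normK ?num_real// /u mulrnAr -mulr_natr; field.
  by field.
by rewrite mulr_ge0 ?sqr_ge0// ltW.
Qed.

Let int_norm_mul_phi : mu.-integrable setT (EFin \o (fun x => `|x| * phi x)).
Proof.
apply: (@le_integrable _ _ R mu setT measurableT _
  (fun x => ((s * Num.sqrt 2)%:E * (normal_pdf 0 (s * Num.sqrt 2) x)%:E)%E)).
- by apply/measurable_EFinP; apply: measurable_funM => //.
- move=> x _ /=; rewrite lee_fin normrM normr_id (ger0_norm (phi_ge0 x)).
  rewrite [leRHS]ger0_norm -?mulrA ?norm_mul_phi//.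
  by rewrite !mulr_ge0// ?sqrtr_ge0// ?normal_pdf_ge0// ltW.
- apply: integrableZl => //; exact: integrable_normal_pdf.
Qed.

Let chf y : R := \int[mu]_x (cos (y * x) * phi x).

Let bounded_mul_phi_integrable (g : R -> R) : continuous g ->
  (forall x, `|g x| <= 1) -> mu.-integrable setT (EFin \o (fun x => g x * phi x)).
Proof.
move=> cg g1; apply: (@le_integrable _ _ R mu setT measurableT _ (EFin \o phi)).
- apply/measurable_EFinP; apply: measurable_funM => //.
  exact: continuous_measurable_fun.
- move=> x _ /=; rewrite lee_fin normrM ler_piMl//.
- exact: integrable_normal_pdf.
Qed.

Let mul_continuous y : continuous (fun x : R => y * x).
Proof. by move=> x; apply: cvgM => //; exact: cvg_cst. Qed.

Let cos_continuous y : continuous (fun x : R => cos (y * x)).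
Proof. by move=> x; apply: continuous_comp; [exact: mul_continuous|exact: continuous_cos]. Qed.

Let sin_continuous y : continuous (fun x : R => sin (y * x)).
Proof. by move=> x; apply: continuous_comp; [exact: mul_continuous|exact: continuous_sin]. Qed.

Let int_sin_mul_phi y :
  mu.-integrable setT (EFin \o (fun x => - x * sin (y * x) * phi x)).
Proof.
apply: le_integrable int_norm_mul_phi => //.
- apply/measurable_EFinP; apply: measurable_funM => //; apply: measurable_funM => //.
  exact: continuous_measurable_fun.
- move=> x _ /=; rewrite lee_fin !normrM normrN normr_id ler_wpM2r//.
  by rewrite ler_piMr// sin_max.
Qed.

Let is_derive_mul y x : is_derive x (1 : R) (fun x : R => y * x) y.
Proof.
rewrite (_ : (fun x => _) = y \*: (id : R -> R))//.
by apply: is_derive_eq; rewrite /GRing.scale/= mulr1.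
Qed.

(* Gaussian integration by parts. *)
Let integral_sin_mul_phi y :
  \int[mu]_x (- x * sin (y * x) * phi x) = - (s ^+ 2 * y) * chf y.
Proof.
have int1 := bounded_mul_phi_integrable (@cos_continuous y) (fun x => cos_max (y * x)).
have int2 := int_sin_mul_phi y.
have := @integral_derivative_eq0 (fun x => sin (y * x) * phi x)
  (fun x => y * (cos (y * x) * phi x) + (s ^+ 2)^-1 * (- x * sin (y * x) * phi x)).
rewrite RintegralD//=; last 2 first.
- exact: (@integrableZl _ _ _ mu setT measurableT y _ int1).
- exact: (@integrableZl _ _ _ mu setT measurableT (s ^+ 2)^-1 _ int2).
rewrite !RintegralZl//= -/(chf y) => h.
have : y * chf y + (s ^+ 2)^-1 * (\int[mu]_x (- x * sin (y * x) * phi x)) = 0.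
  (* The bound on [|z| phi z] gives decay of order [1 / (n + 1)], so the boundary terms of the
     integration by parts vanish. *)
  have phi0 n (z : R) : `|z| = n.+1%:R ->
      `|sin (y * z) * phi z| <= s * (Num.sqrt 2 * normal_peak (s * Num.sqrt 2)) * n.+1%:R^-1.
    move=> zn; rewrite normrM (ger0_norm (phi_ge0 z)).
    apply: (@le_trans _ _ (phi z)); first by rewrite ler_piMl// sin_max.
    rewrite ler_pdivlMr// mulrC -zn (le_trans (norm_mul_phi z))//.
    rewrite ler_pM2l// ler_wpM2l ?sqrtr_ge0//.
    by rewrite normal_pdf_ub// mulf_neq0// gt_eqF// sqrtr_gt0.
  have cv0 (z : nat -> R) : (forall n, `|z n.+1| = n.+1%:R) ->
      sin (y * z n) * phi (z n) @[n --> \oo] --> (0 : R).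
    move=> zn; rewrite -(cvg_shiftS (fun n => sin (y * z n) * phi (z n))).
    apply/cvgr0Pnorm_le => e e0; near=> n.
    apply: le_trans (phi0 n _ (zn n)) _.
    near: n.
    set c := s * _.
    have : c * n.+1%:R^-1 @[n --> \oo] --> c * 0.
      by apply: cvgM; [exact: cvg_cst|exact: cvg_harmonic].
    rewrite mulr0 => /cvgr0Pnorm_le/(_ _ e0); apply: filterS => n.
    exact: le_trans (ler_norm _).
  apply: h.
  - move=> x.
    have hs : is_derive x (1 : R) (fun x => sin (y * x)) (y * cos (y * x)).
      by apply: (is_derive_eq (is_derive1_comp _ (@is_derive_mul y x))); rewrite mulrC.
    apply: (is_derive_eq (is_deriveM hs (is_derive_phi x))).
    rewrite /GRing.scale/=; by field.
  - move=> x; apply: cvgD; apply: cvgM; first exact: cvg_cst.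
    + by apply: cvgM; [exact: cos_continuous|exact: cphi].
    + exact: cvg_cst.
    + apply: cvgM; last exact: cphi.
      by apply: cvgM; [apply: cvgN|exact: sin_continuous].
  - have i1 := @integrableZl _ _ _ mu setT measurableT y _ int1.
    have i2 := @integrableZl _ _ _ mu setT measurableT (s ^+ 2)^-1 _ int2.
    exact: (@integrableD _ _ _ mu setT measurableT _ _ i1 i2).
  - by apply: cv0 => n; rewrite ger0_norm.
  - by apply: cv0 => n; rewrite normrN ger0_norm.
move=> /(congr1 (fun z => s ^+ 2 * z)).
rewrite mulr0 mulrDr mulrA mulrA divff ?expf_neq0// mul1r => /eqP.
by rewrite addrC addr_eq0 => /eqP ->; rewrite mulNr.
Unshelve. all: end_near. Qed.

(** The integrand is differentiated under the integral sign, dominated by [|x| phi x] uniformly in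
    the parameter; integration by parts then closes the differential equation. *)
Let is_derive_chf y : is_derive y (1 : R) chf (- (s ^+ 2 * y) * chf y).
Proof.
have dcos x z : is_derive z (1 : R) (fun y => cos (y * x) * phi x)
    (- x * sin (z * x) * phi x).
  have hm : is_derive z (1 : R) (fun y : R => y * x) x.
    rewrite (_ : (fun y => _) = (fun y => x * y)); first exact: is_derive_mul.
    by apply/funext => w; rewrite mulrC.
  have hc : is_derive z (1 : R) (fun y => cos (y * x)) (- x * sin (z * x)).
    by apply: (is_derive_eq (is_derive1_comp _ hm)); rewrite mulNr mulrC mulNr.
  rewrite (_ : (fun y => _) = (phi x) \*: (fun y => cos (y * x))); last first.
    by apply/funext => w /=; rewrite mulrC.
  apply: is_derive_eq.
  by rewrite /GRing.scale/= mulrC.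
pose f (y x : R) := cos (y * x) * phi x.
have d1f z x : partial1of2 f z x = - x * sin (z * x) * phi x.
  by rewrite partial1of2E; case: (dcos x z).
have Iy : (`]y - 1, y + 1[%classic : set R) y.
  by rewrite /= in_itv/= ltrBlDr ltrDl ltr01.
have intf z : (`]y - 1, y + 1[%classic : set R) z -> mu.-integrable setT (EFin \o f z).
  move=> _; apply: bounded_mul_phi_integrable; first exact: cos_continuous.
  by move=> x; exact: cos_max.
have df z x : (`]y - 1, y + 1[%classic : set R) z -> setT x -> derivable (f^~ x) z 1.
  by move=> _ _; case: (dcos x z).
have G0 x : 0 <= `|x| * phi x by rewrite mulr_ge0.
have Gub z x : (`]y - 1, y + 1[%classic : set R) z -> setT x ->
   `|partial1of2 f z x| <= `|x| * phi x.
  move=> _ _; rewrite d1f !normrM normrN (ger0_norm (phi_ge0 x)) ler_wpM2r//.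
  by rewrite ler_piMr// sin_max.
apply: DeriveDef.
  exact: (derivable_under_integral measurableT Iy intf df G0 int_norm_mul_phi Gub).
rewrite -derive1E.
rewrite (differentiation_under_integral measurableT Iy intf df G0 int_norm_mul_phi Gub).
rewrite -integral_sin_mul_phi; apply: eq_Rintegral => x _; exact: d1f.
Qed.

(** Because [chf' = - s^2 y chf], the product of [chf] with [e] has zero derivative and keeps its
    value 1 at the origin. *)
Lemma Rintegral_cos_normal_pdf y :
  \int[mu]_x (cos (y * x) * normal_pdf 0 s x) = expR (- (s ^+ 2 * y ^+ 2 / 2)).
Proof.
rewrite -/phi -/(chf y).
pose e z := expR (s ^+ 2 * z ^+ 2 / 2).
have de z : is_derive z (1 : R) e (s ^+ 2 * z * e z).
  have h : is_derive z (1 : R) (fun z : R => s ^+ 2 * z ^+ 2 / 2) (s ^+ 2 * z).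
    rewrite (_ : (fun x => _) = (s ^+ 2 / 2) \*: (fun x : R => x ^+ 2)); last first.
      by apply/funext => w /=; rewrite /GRing.scale/= mulrAC.
    apply: is_derive_eq; rewrite /GRing.scale/=.
    by field.
  by apply: (is_derive_eq (is_derive1_comp _ h)); rewrite mulrC.
have : chf y * e y = chf 0 * e 0.
  apply: (@is_derive_0_is_cst R (fun z => chf z * e z)) => z.
  apply: (is_derive_eq (is_deriveM (is_derive_chf z) (de z))).
  by rewrite /GRing.scale/=; ring.
have -> : chf 0 = 1.
  rewrite /chf; under eq_Rintegral do rewrite mul0r cos0 mul1r.
  by rewrite /Rintegral integral_normal_pdf.
rewrite /e expr0n/= mulr0 mul0r expR0 mulr1 expRN => h.
by rewrite -[LHS](mulfK (lt0r_neq0 (expR_gt0 (s ^+ 2 * y ^+ 2 / 2)))) h mul1r.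
Qed.

End gaussian.

(** * Integrals against a normal law *)

Section normal_integrals.
Context (R : realType).
Notation mu := (@lebesgue_measure R).

(** The Radon-Nikodym derivative and the density have equal integrals over every measurable set,
    hence agree almost everywhere. *)
Lemma integral_normal_prob (m s : R) (f : R -> \bar R) :
  (normal_prob m s).-integrable setT f ->
  (\int[normal_prob m s]_x f x = \int[mu]_x (f x * (normal_pdf m s x)%:E))%E.
Proof.
move=> intf; have mf := measurable_int _ intf.
rewrite -(Radon_Nikodym_change_of_variables (normal_prob_dominates m s))//=.
apply: ae_eq_integral => //.
- apply: emeasurable_funM => //; apply: (measurable_int mu).
  by apply: Radon_Nikodym_integrable; exact: normal_prob_dominates.
- apply: emeasurable_funM => //=; apply/measurableT_comp => //=.
  exact: measurable_normal_pdf.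
- apply: ae_eqe_mul2l => /=.
  rewrite Radon_NikodymE//=; first exact: normal_prob_dominates.
  move=> abmu; case: cid => /= h [h1 h2 h3].
  apply: integral_ae_eq => //=.
  + by apply/measurableT_comp =>//; exact: measurable_normal_pdf.
  + by move=> E E01 mE; rewrite -h3.
Qed.

Lemma bounded_integrable d (T : measurableType d) (P : probability T R)
    (f : T -> R) (M : R) : measurable_fun setT f -> (forall x, `|f x| <= M) ->
  P.-integrable setT (EFin \o f).
Proof.
move=> mf fM; apply: (@le_integrable _ _ R P setT measurableT _ (EFin \o cst M)).
- exact/measurable_EFinP.
- by move=> x _ /=; rewrite lee_fin (le_trans (fM x))// ler_norm.
- exact: finite_measure_integrable_cst.
Qed.

(* Completing the square: the integrand is a multiple of another normal
   density. *)
Lemma integral_expR_normal (q m : R) : 0 <= q ->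
  (\int[mu]_x ((expR (- (m * x + q * x ^+ 2 / 2)) * normal_pdf 0 1 x)%:E) =
   ((Num.sqrt (1 + q))^-1 * expR (m ^+ 2 / (2 * (1 + q))))%:E)%E.
Proof.
move=> q0; have q1 : 0 < 1 + q by rewrite ltr_pwDl.
pose s := (Num.sqrt (1 + q))^-1.
have s0 : 0 < s by rewrite invr_gt0 sqrtr_gt0.
pose c := s * expR (m ^+ 2 / (2 * (1 + q))).
transitivity (\int[mu]_x (c%:E * (normal_pdf (- m / (1 + q)) s x)%:E))%E.
  apply: eq_integral => x _; rewrite -EFinM; congr EFin.
  rewrite !normal_pdfE ?oner_neq0 ?gt_eqF// /normal_fun /normal_peak /c.
  have s2 : s ^+ 2 = (1 + q)^-1 by rewrite /s exprVn sqr_sqrtr// ltW.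
  rewrite s2 expr1n mul1r.
  have -> : Num.sqrt ((1 + q)^-1 * pi *+ 2) = s * Num.sqrt (pi *+ 2).
    by rewrite -mulrnAr sqrtrM ?invr_ge0 ?(ltW q1)// sqrtrV// ltW.
  set N := Num.sqrt (pi *+ 2).
  have N0 : N != 0 by rewrite gt_eqF// sqrtr_gt0 pmulrn_lgt0// pi_gt0.
  have -> z w : s * z * ((s * N)^-1 * w) = N^-1 * (z * w).
    by field; rewrite N0 gt_eqF.
  rewrite mulrCA -!expRD; congr (_ * expR _).
  by field; rewrite gt_eqF.
rewrite integralZl//; last exact: integrable_normal_pdf.
by rewrite integral_normal_pdf mule1.
Qed.

End normal_integrals.

(** * Laplace transform of a Gaussian quadratic form *)

(** Sylvester's identity, from two block triangular factorizations of one matrix. *)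
Lemma det_add1_mulmxC (K : comNzRingType) m n (A : 'M[K]_(m, n)) (B : 'M[K]_(n, m)) :
  \det (1%:M + A *m B) = \det (1%:M + B *m A).
Proof.
transitivity (\det (block_mx 1%:M (- B) A 1%:M)).
  have -> : block_mx 1%:M (- B) A 1%:M =
      block_mx 1%:M 0 A 1%:M *m block_mx 1%:M (- B) 0 (1%:M + A *m B).
    by rewrite mulmx_block !mul1mx !mul0mx mulmx1 mulmxN !addr0 addrCA addNr addr0.
  by rewrite det_mulmx det_lblock det_ublock !det1 !mul1r.
have -> : block_mx 1%:M (- B) A 1%:M =
    block_mx 1%:M (- B) 0 1%:M *m block_mx (1%:M + B *m A) 0 A 1%:M.
  by rewrite mulmx_block !mul1mx !mul0mx !mulmx1 mulNmx !add0r addrK.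
by rewrite det_mulmx det_lblock det_ublock !det1 !mul1r mulr1.
Qed.

Section gaussian_quadratic_form.
Context (R : realType) (d : measure_display) (T : measurableType d).
Variable P : probability T R.
Variables (n : nat) (Z : T -> 'cV[R]_n) (S : 'M[R]_n).
Hypotheses (psdS : symmetric_psd S) (ZS : normal_vector P Z S).

Let lin (u : 'cV[R]_n) (x : T) : R := (u^T *m Z x) 0 0.

Let linD u v x : lin (u + v) x = lin u x + lin v x.
Proof. by rewrite /lin linearD/= mulmxDl mxE. Qed.

Let linZ a u x : lin (a *: u) x = a * lin u x.
Proof. by rewrite /lin linearZ/= -scalemxAl mxE. Qed.

Let mlin u : measurable_fun setT (lin u).
Proof. exact: (ZS u).1. Qed.

Let mcos : measurable_fun setT (@cos R).
Proof. by apply: continuous_measurable_fun; exact: continuous_cos. Qed.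

(** The only point where the Gaussian law of [Z] enters: the integral depends on a single functional
    and is computed on its image law. *)
Lemma integral_cos_normal_vector w :
  (\int[P]_x (cos (lin w x))%:E = (expR (- (bil S w w / 2)))%:E)%E.
Proof.
have [mw law] := ZS w.
have mw' : measurable_fun setT (lin w : T -> measurableTypeR R) by exact: mw.
pose mm := isMeasurableFun.Build _ _ _ _ _ mw'.
pose Y : {mfun T >-> measurableTypeR R} := MeasurableFun.Pack (MeasurableFun.Class mm).
have intc (Q : probability (measurableTypeR R) R) : Q.-integrable setT (EFin \o @cos R).
  by apply: (@bounded_integrable _ _ _ _ _ 1) => // x; exact: cos_max.
have E : (\int[P]_x (cos (lin w x))%:E =
          \int[pushforward P Y]_x (cos x)%:E)%E.
  rewrite (@integral_pushforward _ _ _ _ _ Y _ P setT (EFin \o cos))//=.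
  - exact/measurable_EFinP.
  - rewrite preimage_setT; apply: (@bounded_integrable _ _ _ _ _ 1).
      by apply: measurableT_comp.
    by move=> x; exact: cos_max.
have v0 : 0 <= bil S w w by exact: psdS.2.
(* At zero variance the law is a point mass at 0, and [cos 0 = 1] agrees with the formula. *)
rewrite E; have [v_eq0|vn0] := eqVneq (bil S w w) 0.
  transitivity (\int[\d_((0%R : R) : measurableTypeR R)]_x (cos x)%:E)%E.
    apply: eq_measure_integral => A mA _; rewrite [LHS](law A mA) /centered_normal.
    by rewrite -/(bil S w w) v_eq0 eqxx.
  rewrite integral_dirac//=; last exact/measurable_EFinP.
  by rewrite diracT mul1e cos0 v_eq0 mul0r oppr0 expR0.
have s0 : 0 < Num.sqrt (bil S w w) by rewrite sqrtr_gt0 lt_neqAle eq_sym vn0.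
transitivity (\int[normal_prob 0 (Num.sqrt (bil S w w))]_x (cos x)%:E)%E.
  apply: eq_measure_integral => A mA _; rewrite [LHS](law A mA) /centered_normal.
  by rewrite -/(bil S w w) (negPf vn0).
rewrite integral_normal_prob; last exact: intc.
have := @Rintegral_cos_normal_pdf R _ s0 1.
rewrite expr1n mulr1 sqr_sqrtr// => <-.
rewrite /Rintegral fineK; first by apply: eq_integral => x _; rewrite mul1r EFinM.
apply: integrable_fin_num => //.
apply: (@le_integrable _ _ R (@lebesgue_measure R) setT measurableT _
   (EFin \o normal_pdf 0 (Num.sqrt (bil S w w)))).
- apply/measurable_EFinP; apply: measurable_funM.
    by apply: measurableT_comp => //; exact: measurable_funM.
  exact: measurable_normal_pdf.
- move=> x _ /=; rewrite lee_fin normrM ler_piMl//.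
  exact: cos_max.
- exact: integrable_normal_pdf.
Qed.

(* For Q the sum of the u u^T, cond_cov us = S (1 + Q S)^-1 and
   cond_det us = det (1 + Q S), computed by rank-one updates. *)
Fixpoint cond_cov (us : seq 'cV[R]_n) : 'M[R]_n :=
  if us is u :: us' then downdate 1 (cond_cov us') u else S.

Fixpoint cond_det (us : seq 'cV[R]_n) : R :=
  if us is u :: us' then
    cond_det us' * (1 + bil (cond_cov us') u u) else 1.

Lemma symmetric_psd_cond_cov us : symmetric_psd (cond_cov us).
Proof.
elim: us => //= u us IH; apply: symmetric_psd_downdate => //.
by rewrite ltr_pwDl//; exact: IH.2.
Qed.

Lemma cond_det_gt0 us : 0 < cond_det us.
Proof.
elim: us => //= u us IH; rewrite mulr_gt0// ltr_pwDl//.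
exact: (symmetric_psd_cond_cov us).2.
Qed.

Let weight us x := \prod_(u <- us) expR (- (lin u x ^+ 2 / 2)).

Let mweight us : measurable_fun setT (weight us).
Proof.
rewrite /weight; apply: measurable_prod => u _.
apply: measurableT_comp => //; apply: measurableT_comp => //.
by apply: measurable_funM => //; exact: measurable_funX.
Qed.

Let weight_ge0 us x : 0 <= weight us x.
Proof. by apply: prodr_ge0 => u _; exact: expR_ge0. Qed.

Let weight_le1 us x : weight us x <= 1.
Proof.
rewrite /weight; elim: us => [|u us IH]; first by rewrite big_nil.
rewrite big_cons mulr_ile1 ?expR_ge0 ?prodr_ge0//.
by rewrite -expR0 ler_expR oppr_le0 divr_ge0// sqr_ge0.
Qed.

Let integral_cos_mul_normal (y : R) :
  (\int[normal_prob 0 1]_g (cos (g * y))%:E = (expR (- (y ^+ 2 / 2)))%:E)%E.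
Proof.
rewrite integral_normal_prob; last first.
  apply: (@bounded_integrable _ _ _ _ _ 1).
    by apply: measurableT_comp => //; exact: measurable_funM.
  by move=> x; exact: cos_max.
have := @Rintegral_cos_normal_pdf R 1 ltr01 y.
rewrite expr1n mul1r => <-.
rewrite /Rintegral fineK; first by apply: eq_integral => x _; rewrite mulrC EFinM.
apply: integrable_fin_num => //.
apply: (@le_integrable _ _ R (@lebesgue_measure R) setT measurableT _
   (EFin \o normal_pdf 0 1)).
- apply/measurable_EFinP; apply: measurable_funM.
    by apply: measurableT_comp => //; exact: measurable_funM.
  exact: measurable_normal_pdf.
- move=> x _ /=; rewrite lee_fin normrM ler_piMl//.
  exact: cos_max.
- exact: integrable_normal_pdf.
Qed.

(* Each factor exp(-y^2/2) is the characteristic function of an independent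
   N(0,1) variable g at y; exchanging the two integrals replaces w by w +- g u. *)
Lemma integral_weight_cos us w :
  (\int[P]_x (weight us x * cos (lin w x))%:E =
   ((Num.sqrt (cond_det us))^-1 * expR (- (bil (cond_cov us) w w / 2)))%:E)%E.
Proof.
elim: us w => [|u us IH] w.
  rewrite /= sqrtr1 invr1 mul1r -integral_cos_normal_vector.
  by apply: eq_integral => x _; rewrite /weight big_nil mul1r.
pose N := normal_prob (0 : R) 1.
pose f (z : T * measurableTypeR R) : \bar R :=
  (weight us z.1 * cos (lin w z.1) * cos ((z.2 : R) * lin u z.1))%:E.
have mf : measurable_fun setT f.
  apply/measurable_EFinP; apply: measurable_funM; first apply: measurable_funM.
  - exact: measurableT_comp.
  - by apply: measurableT_comp => //; exact: measurableT_comp.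
  - apply: measurableT_comp => //; apply: measurable_funM => //.
    exact: measurableT_comp.
have f1 z : (`|f z| <= 1)%E.
  rewrite lee_fin !normrM mulr_ile1// ?mulr_ge0//; last exact: cos_max.
  by rewrite mulr_ile1// ?cos_max// ger0_norm.
have intf : (P \x N)%E.-integrable setT f.
  apply/integrable12ltyP; first exact: mf.
  apply: (@le_lt_trans _ _ (\int[P]_x \int[N]_y 1)%E).
    apply: ge0_le_integral => //.
    - by move=> x _; apply: integral_ge0.
    - apply: (@measurable_fun_fubini_tonelli_F _ _ _ _ _ N (abse \o f)) => //.
      exact: measurableT_comp mf.
      by move=> z; exact: abse_ge0.
    - move=> x _; apply: ge0_le_integral => //.
      by apply: measurableT_comp => //; exact: (measurableT_comp mf).
  under eq_integral do rewrite integral_cst//= probability_setT mule1.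
  by rewrite integral_cst//= probability_setT mule1 ltry.
set q := bil (cond_cov us) u u.
have q0 : 0 <= q by exact: (symmetric_psd_cond_cov us).2.
set b := bil (cond_cov us) u w.
set c := bil (cond_cov us) w w.
transitivity (\int[P]_x \int[N]_g f (x, g))%E.
  apply: eq_integral => x _.
  rewrite /weight big_cons -/(weight us x) -mulrA EFinM -integral_cos_mul_normal.
  rewrite muleC -integralZl//.
  apply: (@bounded_integrable _ _ _ _ _ 1).
    by apply: measurableT_comp => //; exact: measurable_funM.
  by move=> y; exact: cos_max.
rewrite (Fubini intf).
pose k := (Num.sqrt (cond_det us))^-1 * expR (- (c / 2)).
pose h (t g : R) := expR (- (t * b * g + q * g ^+ 2 / 2)).
(* For fixed g the two cosines combine into the mean of the cosines at [w + g u] and [w - g u], to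
   which the induction hypothesis applies. Expanding its quadratic form leaves in g the coefficient
   [q] and the linear term [b] with either sign. *)
have inner g : (\int[P]_x f (x, g) = (k * (2^-1 * h 1 g + 2^-1 * h (-1) g))%:E)%E.
  transitivity (\int[P]_x ((2^-1 * (weight us x * cos (lin (w + g *: u) x)))%:E +
     (2^-1 * (weight us x * cos (lin (w + (- g) *: u) x)))%:E))%E.
    apply: eq_integral => x _; rewrite -EFinD; congr EFin.
    by rewrite !linD !linZ mulNr cosB cosD /=; field.
  have intw v : P.-integrable setT (EFin \o (fun x => weight us x * cos (lin v x))).
    apply: (@bounded_integrable _ _ _ _ _ 1).
      by apply: measurable_funM => //; exact: measurableT_comp.
    by move=> x; rewrite normrM mulr_ile1// ?cos_max// ger0_norm.
  rewrite integralD//; last 2 first.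
  - exact: (@integrableZl _ _ _ P setT measurableT 2^-1 _ (intw _)).
  - exact: (@integrableZl _ _ _ P setT measurableT 2^-1 _ (intw _)).
  have half v : (\int[P]_x (2^-1 * (weight us x * cos (lin v x)))%:E =
      (2^-1)%:E * \int[P]_x (weight us x * cos (lin v x))%:E)%E.
    by rewrite -integralZl//; exact: intw.
  rewrite !half !IH -!EFinM -EFinD; congr EFin.
  have bE t : bil (cond_cov us) (w + t *: u) (w + t *: u) =
      c + 2 * t * b + t ^+ 2 * q.
    rewrite !bilDl !bilDr !bilZl !bilZr -/q -/b -/c.
    rewrite (bilC w u (symmetric_psd_cond_cov us).1) -/b; ring.
  have hE t : expR (- ((c + 2 * t * b + t ^+ 2 * q) / 2)) =
      expR (- (c / 2)) * expR (- (t * b + q * t ^+ 2 / 2)).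
    by rewrite -expRD; congr expR; field.
  have -> : h 1 g = expR (- (g * b + q * g ^+ 2 / 2)).
    by congr expR; ring.
  have -> : h (-1) g = expR (- (- g * b + q * (- g) ^+ 2 / 2)).
    by congr expR; ring.
  by rewrite !bE !hE /k; ring.
under eq_integral do rewrite inner.
have mh t : measurable_fun setT (fun g : measurableTypeR R => h t g).
  rewrite (_ : (fun g => _) =
      (fun g : measurableTypeR R => expR (- (t * b) * g + - (q / 2) * g ^+ 2))); last first.
    by apply/funext => g; congr expR; field.
  apply: measurableT_comp => //; apply: measurable_funD; first exact: measurable_funM.
  by apply: measurable_funM => //; exact: measurable_funX.
rewrite integral_normal_prob; last first.
  apply: (@bounded_integrable _ _ _ _ _ 1).
    by apply: measurable_funM => //; apply: measurable_funD; apply: measurable_funM.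
  (* The closed form is bounded by 1 because it is the integral of [f (x, g)] over a probability
     space and [|f| <= 1]. *)
  move=> g; rewrite -lee_fin -abse_EFin -inner.
  apply: le_trans (le_abse_integral _ _ _) _ => //.
    by apply/measurable_EFinP; apply: measurable_funM => //;
      [apply: measurable_funM => //; exact: measurableT_comp
      |apply: measurableT_comp => //; exact: measurable_funM].
  apply: (@le_trans _ _ (\int[P]_x 1)%E).
    apply: ge0_le_integral => //.
    by apply: measurableT_comp => //; apply/measurable_EFinP; apply: measurable_funM => //;
      [apply: measurable_funM => //; exact: measurableT_comp
      |apply: measurableT_comp => //; exact: measurable_funM].
  by rewrite integral_cst//= probability_setT mule1.
have hI t : t ^+ 2 = 1 -> (\int[@lebesgue_measure R]_g (h t g * normal_pdf 0 1 g)%:E =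
    ((Num.sqrt (1 + q))^-1 * expR (b ^+ 2 / (2 * (1 + q))))%:E)%E.
  move=> t1; rewrite integral_expR_normal//.
  by rewrite exprMn t1 mul1r.
transitivity ((k * 2^-1)%:E * (\int[@lebesgue_measure R]_g (h 1 g * normal_pdf 0 1 g)%:E
  + \int[@lebesgue_measure R]_g (h (-1) g * normal_pdf 0 1 g)%:E))%E.
  have mhp t : measurable_fun setT
      (fun g : measurableTypeR R => (h t g * normal_pdf 0 1 g)%:E).
    by apply/measurable_EFinP; apply: measurable_funM => //; exact: measurable_normal_pdf.
  have hp0 t g : (0 <= (h t g * normal_pdf 0 1 g)%:E)%E.
    by rewrite lee_fin mulr_ge0 ?expR_ge0 ?normal_pdf_ge0.
  have k0 : 0 <= k by rewrite mulr_ge0 ?expR_ge0// invr_ge0 sqrtr_ge0.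
  rewrite -ge0_integralD//= -ge0_integralZl//=.
  - by apply: eq_integral => g _; rewrite -EFinD -!EFinM; congr EFin; ring.
  - exact: emeasurable_funD.
  - by move=> g _; rewrite adde_ge0.
  - by rewrite lee_fin mulr_ge0.
rewrite !hI ?expr1n ?sqrrN ?expr1n//.
rewrite -EFinD -EFinM; congr EFin.
rewrite [cond_det (u :: us)]/= [cond_cov (u :: us)]/= bil_downdate (bilC w u (symmetric_psd_cond_cov us).1) -/b -/q -/c.
rewrite sqrtrM ?(ltW (cond_det_gt0 us))// [(Num.sqrt _ * Num.sqrt _)^-1]invfM /k.
rewrite (_ : - ((c - _) / 2) = - (c / 2) + b ^+ 2 / (2 * (1 + q))); last first.
  by field; rewrite gt_eqF// ltr_pwDl.
rewrite expRD. field.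
by rewrite !gt_eqF ?sqrtr_gt0 ?cond_det_gt0// ltr_pwDl.
Qed.

(** Take [w = 0], so that the cosine is 1, and scale the vectors by [sqrt (2 t)], so that each
    weight [exp(- y^2 / 2)] becomes [exp(- t y^2)]. *)
Lemma integral_expR_quadratic (vs : seq 'cV[R]_n) (t : R) : 0 <= t ->
  (\int[P]_x (expR (- t * \sum_(v <- vs) (lin v x) ^+ 2))%:E =
   ((Num.sqrt (\det (1%:M + (2 * t) *: ((\sum_(v <- vs) v *m v^T) *m S))))^-1)%:E)%E.
Proof.
move=> t0; pose r := Num.sqrt (2 * t).
have r2 : r ^+ 2 = 2 * t by rewrite sqr_sqrtr// mulr_ge0.
have condE us : cond_cov us *m (1%:M + (\sum_(u <- us) u *m u^T) *m S) = S /\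
    cond_det us = \det (1%:M + (\sum_(u <- us) u *m u^T) *m S).
  elim: us => [|u us [IH1 IH2]]; first by rewrite big_nil mul0mx addr0 mulmx1 det1.
  rewrite big_cons /=.
  set C := cond_cov us in IH1 *; set M := 1%:M + _ in IH1 IH2.
  have q0 : 0 < 1 + bil C u u.
    by rewrite ltr_pwDl//; exact: (symmetric_psd_cond_cov us).2.
  (* Since [C M = S], the new factor splits off on the left. The Sherman-Morrison formula then
     inverts it, and Sylvester's identity gives its determinant [1 + u^T C u]. *)
  have -> : 1%:M + (u *m u^T + \sum_(u <- us) u *m u^T) *m S =
      (1%:M + u *m u^T *m C) *m M.
    rewrite [RHS]mulmxDl mul1mx -(mulmxA (u *m u^T)) IH1 /M mulmxDl -addrA.
    by congr (_ + _); rewrite addrC.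
  have VuE : u^T *m C *m u = (bil C u u)%:M by rewrite [LHS]mx11_scalar.
  split.
    rewrite -[RHS]IH1 [LHS]mulmxA; congr (_ *m _).
    rewrite /downdate mulmxBl !mulmxDr !mulmx1 -scalemxAl -[u *m _ *m C]mulmxA.
    rewrite [C *m (u *m _)]mulmxA.
    have -> : C *m u *m (u^T *m C) *m (u *m (u^T *m C)) =
        bil C u u *: (C *m u *m (u^T *m C)).
      by rewrite -mulmxA [_ *m (u *m _)]mulmxA VuE mul_scalar_mx -scalemxAr.
    rewrite scalerA -scalerDl -[X in X + _ * _]mulr1 -mulrDr mulVf ?gt_eqF//.
    by rewrite scale1r addrK.
  rewrite det_mulmx -IH2 mulrC; congr (_ * _).
  by rewrite -mulmxA det_add1_mulmxC VuE det_mx11 !mxE.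
have := integral_weight_cos [seq r *: v | v <- vs] 0.
rewrite (condE _).2.
have -> : bil (cond_cov [seq r *: v | v <- vs]) 0 0 = 0.
  by rewrite /bil mulmx0 mxE.
rewrite mul0r oppr0 expR0 mulr1.
have -> : 1%:M + (2 * t) *: ((\sum_(v <- vs) v *m v^T) *m S) =
    1%:M + (\sum_(u <- [seq r *: v | v <- vs]) u *m u^T) *m S.
  congr (_ + _); rewrite scalemxAl scaler_sumr big_map; congr (_ *m _).
  apply: eq_bigr => v _; rewrite linearZ/= -scalemxAl -scalemxAr scalerA.
  by rewrite -expr2 r2.
move=> <-; apply: eq_integral => x _; congr EFin.
have -> : lin 0 x = 0 by rewrite /lin trmx0 mul0mx mxE.
rewrite cos0 mulr1 /weight big_map -expR_sum mulr_sumr; congr expR.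
by apply: eq_bigr => v _; rewrite linZ exprMn r2; field.
Qed.

End gaussian_quadratic_form.

(** * Expectation of a product of independent variables *)

Section layer_cake.
Context (R : realType) (d : measure_display) (T : measurableType d).
Notation mu := (@lebesgue_measure R).

(** The layer-cake formula: a nonnegative function is a mixture of the indicators of its superlevel
    sets. *)
Lemma integral_indic_lt (a : R) : 0 <= a ->
  (\int[mu]_u (((0 <= u) && (u < a))%:R)%:E = a%:E)%E.
Proof.
move=> a0.
rewrite (eq_integral (fun u : measurableTypeR R =>
  (\1_(`[0%R, a[%classic : set R) u)%:E)); last first.
  move=> u _; rewrite indicE; congr ((_ %:R)%:E).
  by rewrite mem_setE in_itv.
rewrite integral_indic//= setIT lebesgue_measure_itv/= lte_fin.
by case: ltgtP a0 => // [? _|<- _] //; rewrite oppr0 adde0.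
Qed.

Lemma measurable_between (F : T -> R) : measurable_fun setT F ->
  measurable_fun setT (fun z : T * measurableTypeR R =>
    (((0 <= (z.2 : R)) && ((z.2 : R) < F z.1))%:R : R)).
Proof.
move=> mF; pose A := [set z : T * measurableTypeR R | (0 <= (z.2 : R)) && ((z.2 : R) < F z.1)].
rewrite (_ : (fun z => _) = (\1_A : _ -> R)); last first.
  by apply/funext => z; rewrite indicE mem_setE.
apply: measurable_indic.
have m2 : measurable_fun setT (fun z : T * measurableTypeR R => z.2 : R).
  exact: measurable_snd.
have m1 : measurable_fun setT (fun z : T * measurableTypeR R => F z.1).
  by apply: measurableT_comp => //; exact: measurable_fst.
have mb : measurable_fun setT (fun z : T * measurableTypeR R =>
   (0 <= (z.2 : R)) && ((z.2 : R) < F z.1)).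
  apply: measurable_and; first exact: measurable_fun_ler.
  exact: measurable_fun_ltr.
by have := mb measurableT [set true] I; rewrite setTI.
Qed.

End layer_cake.

Section independence.
Context (R : realType) (d d' : measure_display).
Context (T : measurableType d) (E : measurableType d') (P : probability T R).
Variable H : nat -> T -> E.
Hypothesis mH : forall k, measurable_fun setT (H k).
Hypothesis indepH : forall (J : {fset nat}) (B : nat -> set E),
  (forall k, k \in J -> measurable (B k)) ->
  P (\bigcap_(k in [set` J]) (H k @^-1` B k)) = (\prod_(k <- J) P (H k @^-1` B k))%E.

(** Induction on the number j of leading factors that may be arbitrary, the others being indicators.
    For [j = 0] this is independence of events. To pass from j to [j + 1], factor j is written by
    layer cake as an integral of indicators, and Tonelli's theorem moves that integral outside. *)
Lemma integral_indep_prod (K : nat) (f : nat -> E -> R) :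
  (forall k, measurable_fun setT (f k)) -> (forall k e, 0 <= f k e) ->
  (\int[P]_x (\prod_(k < K) f k (H k x))%:E =
   \prod_(k < K) \int[P]_x (f k (H k x))%:E)%E.
Proof.
suff h j : forall f : nat -> E -> R,
    (forall k, measurable_fun setT (f k)) -> (forall k e, 0 <= f k e) ->
    (forall k e, (j <= k < K)%N -> f k e = ((f k e == 1)%:R)) ->
    (\int[P]_x (\prod_(k < K) f k (H k x))%:E =
     \prod_(k < K) \int[P]_x (f k (H k x))%:E)%E.
  move=> mf f0; apply: (h K) => // k e /andP[/leq_ltn_trans/[apply]].
  by rewrite ltnn.
elim: j => [|j IH] {}f mf f0 fI.
  pose B k := f k @^-1` [set 1].
  have mB k : measurable (B k).
    by rewrite /B -[X in measurable X]setTI; exact: mf.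
  have mHB k : measurable (H k @^-1` B k).
    by rewrite -[X in measurable X]setTI; exact: mH.
  have fE k e : (k < K)%N -> f k e = \1_(B k) e.
    move=> kK; rewrite fI//= indicE; congr ((nat_of_bool _)%:R).
    by apply/eqP/idP; rewrite inE.
  pose J := [fset k in iota 0 K]%fset.
  have permJ : perm_eq J (iota 0 K).
    apply: uniq_perm; [exact: fset_uniq|exact: iota_uniq|].
    by move=> k; rewrite !inE.
  have := indepH (J := J) (B := B) (fun k _ => mB k).
  rewrite (perm_big _ permJ)/= -{1}[K in iota 0 K]subn0 -/(index_iota 0 K) big_mkord => PE.
  transitivity (P (\bigcap_(k in [set` J]) (H k @^-1` B k))).
    transitivity (\int[P]_x (\1_(\bigcap_(k in [set` J]) (H k @^-1` B k)) x)%:E)%E.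
      apply: eq_integral => x _; congr EFin; rewrite indicE.
      have [xJ|xJ] := boolP (x \in _).
        rewrite big1// => k _; rewrite fE// indicE mem_set//.
        move: xJ; rewrite inE => /(_ k); apply => /=.
        by rewrite !inE mem_iota add0n ltn_ord.
      have [k kK] : exists2 k, (k < K)%N & ~ B k (H k x).
        apply: contrapT => nB; move/negP: xJ; apply; rewrite inE => k /=.
        rewrite !inE mem_iota/= add0n => kK.
        by apply: contrapT => nBk; apply: nB; exists k.
      move=> nB; rewrite (bigD1 (Ordinal kK))//= fE// indicE.
      by rewrite memNset// mul0r.
    rewrite integral_indic//= ?setIT//.
    apply: fin_bigcap_measurable => // k _; exact: mHB.
  rewrite PE; apply: eq_bigr => k _.
  rewrite (eq_integral (fun x => (\1_(H k @^-1` B k) x)%:E)).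
    by rewrite integral_indic//= setIT.
  by move=> x _; rewrite fE// !indicE.
have [Kj|jK] := leqP K j.
  apply: IH => // k e /andP[jk kK].
  by have := leq_ltn_trans jk kK; rewrite ltnNge Kj.
(* Factor j is replaced by its superlevel indicator at u, which brings the family under the
   induction hypothesis. *)
pose g (u : R) k := if k == j then (fun e => ((0 <= u) && (u < f j e))%:R) else f k.
have Hg u : (\int[P]_x (\prod_(k < K) g u k (H k x))%:E =
     \prod_(k < K) \int[P]_x (g u k (H k x))%:E)%E.
  apply: IH.
  - move=> k; rewrite /g; case: eqP => // _.
    exact: (measurable_fun_pair1 (u : measurableTypeR R) (measurable_between (mf j))).
  - by move=> k e; rewrite /g; case: eqP => // _.
  - move=> k e /andP[jk kK]; rewrite /g; case: eqP => [_|/eqP kj].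
      by case: (_ && _) => /=; rewrite ?eqxx// eq_sym oner_eq0.
    by apply: fI; rewrite kK andbT ltn_neqAle eq_sym kj.
pose oj := Ordinal jK.
pose G x := \prod_(k < K | k != oj) f k (H k x).
have G0 x : 0 <= G x by apply: prodr_ge0.
have gE u x : \prod_(k < K) g u k (H k x) =
    ((0 <= u) && (u < f j (H j x)))%:R * G x.
  rewrite (bigD1 oj)//= {1}/g eqxx; congr (_ * _).
  apply: eq_bigr => k kj; rewrite /g ifF//.
  by apply: contra_neqF kj => /eqP kj; exact: val_inj.
pose F (z : T * measurableTypeR R) : \bar R :=
  (((0 <= (z.2 : R)) && ((z.2 : R) < f j (H j z.1)))%:R * G z.1)%:E.
have mfH k : measurable_fun setT (fun x => f k (H k x)) by exact: measurableT_comp.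
have mG : measurable_fun setT G.
  rewrite (_ : G = fun x => \prod_(k <- [seq k <- index_enum 'I_K | k != oj]) f k (H k x)).
    by apply: measurable_prod => k _.
  by apply/funext => x; rewrite big_filter.
have mF : measurable_fun setT F.
  apply/measurable_EFinP; apply: measurable_funM; first exact: (measurable_between (mfH j)).
  by apply: measurableT_comp => //; exact: measurable_fst.
have F0 z : (0 <= F z)%E by rewrite lee_fin mulr_ge0.
transitivity (\int[P]_x \int[@lebesgue_measure R]_u F (x, u))%E.
  apply: eq_integral => x _; rewrite (bigD1 oj)//= -/(G x).
  rewrite /F/=; under eq_integral do rewrite EFinM.
  rewrite ge0_integralZr//=.
  - by rewrite integral_indic_lt// EFinM.
  - apply/measurable_EFinP.
    exact: (measurable_fun_pair2 x (measurable_between (mfH j))).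
  - by rewrite lee_fin.
rewrite (fubini_tonelli F mF F0).
pose c := (\prod_(k < K | k != oj) \int[P]_x (f k (H k x))%:E)%E.
have c0 : (0 <= c)%E.
  by apply: prode_ge0 => k _; apply: integral_ge0 => x _; rewrite lee_fin.
transitivity (\int[@lebesgue_measure R]_u
   (c * \int[P]_x ((((0 <= u) && (u < f j (H j x)))%:R)%:E)))%E.
  apply: eq_integral => u _.
  transitivity (\int[P]_x (\prod_(k < K) g u k (H k x))%:E)%E.
    by apply: eq_integral => x _; rewrite gE.
  rewrite Hg (bigD1 oj)//= muleC; congr (_ * _)%E; last by rewrite /g eqxx.
  apply: eq_bigr => k kj; apply: eq_integral => x _; rewrite /g ifF//.
  by apply: contra_neqF kj => /eqP kj; exact: val_inj.
pose F' (z : T * measurableTypeR R) : \bar R :=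
  (((0 <= (z.2 : R)) && ((z.2 : R) < f j (H j z.1)))%:R)%:E.
have mF' : measurable_fun setT F'.
  by apply/measurable_EFinP; exact: (measurable_between (mfH j)).
have F'0 z : (0 <= F' z)%E by rewrite lee_fin.
rewrite ge0_integralZl//=; last 2 first.
- exact: (@measurable_fun_fubini_tonelli_G _ _ _ _ _ P F').
- by move=> u _; apply: integral_ge0.
rewrite (bigD1 oj)//= muleC; congr (_ * _)%E.
rewrite -(fubini_tonelli F' mF' F'0); apply: eq_integral => x _.
by rewrite /F'/= integral_indic_lt.
Qed.

End independence.

(** * Received energy and gain of a channel *)

Section complex_measurability.
Context (R : realType) (d : measure_display) (E : measurableType d).
Implicit Types f g : E -> R[i].

Definition cmeasurable f :=
  measurable_fun setT (fun e => complex.Re (f e)) /\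
  measurable_fun setT (fun e => complex.Im (f e)).

Lemma cmeasurable_cst (c : R[i]) : cmeasurable (fun=> c).
Proof. by split; exact: measurable_cst. Qed.

Lemma cmeasurableD f g : cmeasurable f -> cmeasurable g ->
  cmeasurable (fun e => f e + g e).
Proof.
move=> [fr fi] [gr gi]; split.
  rewrite (_ : (fun e => _) = (fun e => complex.Re (f e) + complex.Re (g e))).
    exact: measurable_funD.
  by apply/funext => e; case: (f e) (g e) => [? ?] [].
rewrite (_ : (fun e => _) = (fun e => complex.Im (f e) + complex.Im (g e))).
  exact: measurable_funD.
by apply/funext => e; case: (f e) (g e) => [? ?] [].
Qed.

Lemma cmeasurableM f g : cmeasurable f -> cmeasurable g ->
  cmeasurable (fun e => f e * g e).
Proof.
move=> [fr fi] [gr gi]; split.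
  rewrite (_ : (fun e => _) = (fun e => complex.Re (f e) * complex.Re (g e) -
      complex.Im (f e) * complex.Im (g e))).
    by apply: measurable_funB; exact: measurable_funM.
  by apply/funext => e; case: (f e) (g e) => [? ?] [].
rewrite (_ : (fun e => _) = (fun e => complex.Re (f e) * complex.Im (g e) +
    complex.Im (f e) * complex.Re (g e))).
  by apply: measurable_funD; exact: measurable_funM.
by apply/funext => e; case: (f e) (g e) => [? ?] [].
Qed.

Lemma cmeasurable_conjc f : cmeasurable f -> cmeasurable (fun e => conjc (f e)).
Proof.
move=> [fr fi]; split.
  rewrite (_ : (fun e => _) = (fun e => complex.Re (f e)))//.
  by apply/funext => e; case: (f e).
rewrite (_ : (fun e => _) = (fun e => 0 - complex.Im (f e))).
  exact: measurable_funB.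
by apply/funext => e; case: (f e) => ? ? /=; rewrite sub0r.
Qed.

Lemma cmeasurable_sum (I : Type) (s : seq I) (F : I -> E -> R[i]) :
  (forall i, cmeasurable (F i)) -> cmeasurable (fun e => \sum_(i <- s) F i e).
Proof.
move=> mF; elim: s => [|i s IH].
  by under eq_fun do rewrite big_nil; exact: cmeasurable_cst.
by under eq_fun do rewrite big_cons; exact: cmeasurableD.
Qed.

Lemma cmeasurable_prod (I : Type) (s : seq I) (F : I -> E -> R[i]) :
  (forall i, cmeasurable (F i)) -> cmeasurable (fun e => \prod_(i <- s) F i e).
Proof.
move=> mF; elim: s => [|i s IH].
  by under eq_fun do rewrite big_nil; exact: cmeasurable_cst.
by under eq_fun do rewrite big_cons; exact: cmeasurableM.
Qed.

Lemma cmeasurable_mulmx m n p (A : E -> 'M[R[i]]_(m, n)) (B : E -> 'M[R[i]]_(n, p)) :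
  (forall i j, cmeasurable (fun e => A e i j)) ->
  (forall i j, cmeasurable (fun e => B e i j)) ->
  forall i j, cmeasurable (fun e => (A e *m B e) i j).
Proof.
move=> mA mB i j; under eq_fun do rewrite mxE.
by apply: cmeasurable_sum => k; exact: cmeasurableM.
Qed.

Lemma cmeasurable_det n (A : E -> 'M[R[i]]_n) :
  (forall i j, cmeasurable (fun e => A e i j)) -> cmeasurable (fun e => \det (A e)).
Proof.
move=> mA; rewrite /determinant; apply: cmeasurable_sum => s.
by apply: cmeasurableM; [exact: cmeasurable_cst|exact: cmeasurable_prod].
Qed.

End complex_measurability.

(* A copy of the matrix type, to carry cmx_measurable as its sigma-algebra. *)
Definition cmx_space (R : realType) (m n : nat) : Type := 'M[R[i]]_(m, n).
HB.instance Definition _ (R : realType) m n :=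
  Choice.copy (cmx_space R m n) 'M[R[i]]_(m, n).
HB.instance Definition _ (R : realType) m n :=
  isPointed.Build (cmx_space R m n) (0 : 'M[R[i]]_(m, n)).
HB.instance Definition _ (R : realType) m n :=
  @isMeasurable.Build default_measure_display (cmx_space R m n)
    (@cmx_measurable R m n) (@sigma_algebra0 _ setT _)
    (@sigma_algebraC (cmx_space R m n) _) (@sigma_algebra_bigcup _ setT _).

Section energy_gain.
Context (R : realType) (nr nt : nat) (Sigma : 'M[R]_nt).
Implicit Types h : 'M[R[i]]_(nr, nt).

Definition received h := h *m complexify Sigma *m adjointmx h.

Definition energy h : R := complex.Re (\tr (received h)).

Definition gain (c : R) h : R :=
  complex.Re (\det (1%:M + real_complex R c *: received h)).

Lemma cmeasurable_entry i j :
  cmeasurable (fun h : cmx_space R nr nt => (h : 'M[R[i]]_(nr, nt)) i j).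
Proof.
split=> _ D mD; rewrite setTI; apply: sub_sigma_algebra; exists i, j, D.
  by split=> //; left.
by split=> //; right.
Qed.

Lemma cmeasurable_received i j :
  cmeasurable (fun h : cmx_space R nr nt => received h i j).
Proof.
apply: cmeasurable_mulmx => {}i {}j.
  apply: cmeasurable_mulmx => {}i {}j; first exact: cmeasurable_entry.
  exact: cmeasurable_cst.
under eq_fun do rewrite !mxE.
by apply: cmeasurable_conjc; exact: cmeasurable_entry.
Qed.

Lemma measurable_energy :
  measurable_fun setT (energy : cmx_space R nr nt -> R).
Proof.
suff [] : cmeasurable (fun h : cmx_space R nr nt => \tr (received h)) by [].
by rewrite /mxtrace; apply: cmeasurable_sum => i; exact: cmeasurable_received.
Qed.

Lemma measurable_gain c :
  measurable_fun setT (gain c : cmx_space R nr nt -> R).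
Proof.
suff [] : cmeasurable (fun h : cmx_space R nr nt =>
    \det (1%:M + real_complex R c *: received h)) by [].
apply: cmeasurable_det => i j; under eq_fun do rewrite mxE.
apply: cmeasurableD; first exact: cmeasurable_cst.
under eq_fun do rewrite mxE.
by apply: cmeasurableM; [exact: cmeasurable_cst|exact: cmeasurable_received].
Qed.

Hypothesis psdSigma : symmetric_psd Sigma.

(** One list serves all [c] at once, which allows the limit [c -> 0] at fixed [h] to be taken
    eigenvalue by eigenvalue. *)
Lemma energy_gainE h : exists2 al : seq R, all (>= 0) al &
  energy h = \sum_(x <- al) x /\ forall c, gain c h = \prod_(x <- al) (1 + c * x).
Proof.
have [al al0 [dE tE]] := trace_det_ge0 h psdSigma; exists al => //.
by split=> [|c]; rewrite /energy /gain /received ?tE ?dE.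
Qed.

(** Apply [ln y <= y - 1] at [y = 1 / (1 + x)]; the remaining difference is [x^3 / (1 + x)]. *)
Lemma ln1Dx_ge (x : R) : 0 <= x -> x - x ^+ 2 <= ln (1 + x).
Proof.
move=> x0; have x1 : 0 < 1 + x by lra.
rewrite -[leRHS]opprK lerNr -lnV ?posrE//.
have h : ln (1 + x)^-1 <= (1 + x)^-1 - 1.
  rewrite -[X in ln X](addrNK 1 (1 + x)^-1) addrC; apply: le_ln1Dx.
  by rewrite ltrBrDl subrr invr_gt0.
apply: le_trans h _; rewrite -subr_ge0.
have -> : - (x - x ^+ 2) - ((1 + x)^-1 - 1) = x ^+ 3 / (1 + x).
  by field; rewrite gt_eqF.
by rewrite divr_ge0 ?exprn_ge0// ltW.
Qed.

Lemma gain_ge1 c h : 0 <= c -> 1 <= gain c h.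
Proof.
move=> c0; have [al /allP al0 [_ ->]] := energy_gainE h.
elim: al al0 => [|x al IH] al0; first by rewrite big_nil.
rewrite big_cons -[leLHS]mulr1 ler_pM//.
  by rewrite lerDl mulr_ge0//; apply: al0; rewrite mem_head.
by apply: IH => y yal; apply: al0; rewrite inE yal orbT.
Qed.

Lemma ln_prod_1D (c : R) (al : seq R) : 0 <= c -> all (>= 0) al ->
  ln (\prod_(x <- al) (1 + c * x)) = \sum_(x <- al) ln (1 + c * x).
Proof.
move=> c0; elim: al => [|x al IH] /=; first by rewrite !big_nil ln1.
move=> /andP[x0 al0]; rewrite !big_cons lnM ?IH// posrE.
  by rewrite ltr_pwDl// mulr_ge0.
move: al0 => /allP al0; rewrite big_seq prodr_gt0// => y /al0 y0.
by rewrite ltr_pwDl// mulr_ge0.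
Qed.

Lemma ln_gain_le c h : 0 <= c -> ln (gain c h) <= c * energy h.
Proof.
move=> c0; have [al al0 [-> ->]] := energy_gainE h.
rewrite ln_prod_1D// mulr_sumr big_seq [leRHS]big_seq ler_sum// => x xal.
have x0 : 0 <= c * x by rewrite mulr_ge0// (allP al0).
by apply: le_trans (le_ln1Dx _) _ => //; rewrite (lt_le_trans _ x0).
Qed.

(** Squeezed with error [B / K], the contribution of the quadratic terms of the logarithms. *)
Lemma ln_gain_cvg rho h : 0 < rho ->
  K%:R * ln (gain (rho / K%:R) h) @[K --> \oo] --> rho * energy h.
Proof.
move=> rho0; have [al al0 [eE gE]] := energy_gainE h.
pose B := rho ^+ 2 * \sum_(x <- al) x ^+ 2.
have cvB : rho * energy h - B * K%:R^-1 @[K --> \oo] --> rho * energy h.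
  rewrite -[X in _ --> X]subr0 -[X in _ - X](mulr0 B).
  apply: cvgB; first exact: cvg_cst.
  apply: cvgM; first exact: cvg_cst.
  by rewrite -cvg_shiftS; exact: cvg_harmonic.
apply: (squeeze_cvgr _ cvB (cvg_cst (rho * energy h))).
exists 1%N => // K /= K0; have KR : 0 < K%:R :> R by rewrite ltr0n.
have c0 : 0 <= rho / K%:R by rewrite divr_ge0// ltW.
apply/andP; split; last first.
  have := ln_gain_le h c0; rewrite -(ler_pM2l KR) => /le_trans; apply.
  by rewrite mulrA mulrCA mulfV ?mulr1 ?gt_eqF.
rewrite gE ln_prod_1D// eE /B !mulr_sumr mulr_suml -sumrB.
rewrite big_seq [leRHS]big_seq ler_sum// => x xal.
have x0 : 0 <= rho / K%:R * x by rewrite mulr_ge0// (allP al0).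
have := ln1Dx_ge x0; rewrite -(ler_pM2l KR); apply: le_trans.
rewrite le_eqVlt; apply/orP; left; apply/eqP; field.
by rewrite gt_eqF.
Qed.

End energy_gain.

Section iid_matrices.
Context (R : realType) (d : measure_display) (T : measurableType d).
Variables (P : probability T R) (nr nt : nat) (H : nat -> T -> 'M[R[i]]_(nr, nt)).
Hypothesis iidH : iid P H.

Lemma measurable_iid k : measurable_fun setT (H k : T -> cmx_space R nr nt).
Proof. by case: iidH => mH _ _ _ B mB; rewrite setTI; exact: mH. Qed.

Lemma integral_identically_distributed k (f : cmx_space R nr nt -> R) :
  measurable_fun setT f -> (forall e, 0 <= f e) ->
  (\int[P]_x (f (H k x))%:E = \int[P]_x (f (H 0%N x))%:E)%E.
Proof.
move=> mf f0.
have mm j := isMeasurableFun.Build _ _ _ _ _ (measurable_iid j).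
pose Y j : {mfun T >-> cmx_space R nr nt} := MeasurableFun.Pack (MeasurableFun.Class (mm j)).
have E j : (\int[P]_x (f (H j x))%:E = \int[pushforward P (Y j)]_y (f y)%:E)%E.
  rewrite (@ge0_integral_pushforward _ _ _ _ _ (Y j) (measurable_iid j) P setT (EFin \o f))//=.
    exact/measurable_EFinP.
  by move=> y _; rewrite lee_fin.
rewrite !E; apply: eq_measure_integral => A mA _.
by case: iidH => _ _ /(_ k 0%N A mA).
Qed.

Lemma integral_iid_prod K (f : cmx_space R nr nt -> R) (v : R) :
  measurable_fun setT f -> (forall e, 0 <= f e) ->
  (\int[P]_x (f (H 0%N x))%:E = v%:E)%E ->
  (\int[P]_x (\prod_(k < K) f (H k x))%:E = (v ^+ K)%:E)%E.
Proof.
move=> mf f0 fv; have [_ indH _] := iidH.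
rewrite (@integral_indep_prod _ _ _ _ _ P (H : nat -> T -> cmx_space R nr nt)
   measurable_iid indH K (fun=> f))//.
under eq_bigr do rewrite integral_identically_distributed// fv.
elim: K => [|K IH]; first by rewrite big_ord0.
by rewrite big_ord_recr/= IH -EFinM exprSr.
Qed.

End iid_matrices.

(** * Laplace transform of the received energy *)

Section laplace.
Context (R : realType) (d : measure_display) (T : measurableType d).
Variables (P : probability T R) (nr nt : nat) (X : T -> 'M[R[i]]_(nr, nt)).
Variables (Sigma : 'M[R]_nt) (Psi : 'M[R]_(nr * nt)).
Hypotheses (psdSigma : symmetric_psd Sigma) (psdPsi : symmetric_psd Psi).
Hypothesis XPsi : complex_normal P (fun w => vec (adjointmx (X w))) (complexify Psi).

Let B : 'M[R]_(nr * nt) := tensmx (1%:M : 'M[R]_nr) Sigma.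

Lemma symmetric_psd_kron1 : symmetric_psd B.
Proof.
split=> [|x]; first by rewrite trmx_tens trmx1 psdSigma.1.
(* The form of [1 (x) Sigma] is the sum of the forms of [Sigma] on the [nr] consecutive blocks of
   [x]. *)
have -> : x^T *m B *m x =
   \sum_j (col j (\matrix_(i < nt, j < nr) x (mxtens_index (j, i)) 0))^T *m Sigma *m
     (col j (\matrix_(i < nt, j < nr) x (mxtens_index (j, i)) 0)).
  apply/matrixP => a b; rewrite !ord1 -mulmxA mxE summxE.
  rewrite sum_mxtens; apply: eq_bigr => j _.
  rewrite -mulmxA [RHS]mxE; apply: eq_bigr => i _; rewrite !mxE; congr (_ * _).
  rewrite sum_mxtens (bigD1 j)//= [X in _ + X]big1 ?addr0.
    by apply: eq_bigr => k _; rewrite tensmxE !mxE eqxx mul1r.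
  move=> l lj; apply: big1 => k _.
  by rewrite tensmxE !mxE eq_sym (negPf lj) !mul0r.
by rewrite summxE sumr_ge0// => j _; exact: psdSigma.2.
Qed.

Lemma integral_expR_energy s : 0 <= s ->
  (\int[P]_x (expR (- s * energy Sigma (X x)))%:E =
   ((\det (1%:M + s *: (B *m Psi)))^-1)%:E)%E.
Proof.
move=> s0.
have [us usE] := psd_sum_rank1 psdSigma.
pose S := 2^-1 *: block_mx Psi 0 0 Psi.
have psdS : symmetric_psd S.
  split; first by rewrite linearZ/= tr_block_mx !trmx0 psdPsi.1.
  move=> x; rewrite -[x]vsubmxK tr_col_mx -scalemxAr -scalemxAl mxE.
  rewrite mul_row_block !mulmx0 addr0 add0r mul_row_col mxE.
  by rewrite mulr_ge0// addr_ge0//; exact: psdPsi.2.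
have ZS : normal_vector P (fun w => reim_vec (vec (adjointmx (X w)))) S.
  have ReE : map_mx (@complex.Re R) (complexify Psi) = Psi.
    by apply/matrixP => i j; rewrite !mxE.
  have ImE : map_mx (@complex.Im R) (complexify Psi) = 0.
    by apply/matrixP => i j; rewrite !mxE.
  by have := XPsi; rewrite /complex_normal ReE ImE oppr0.
have := integral_expR_quadratic psdS ZS (energy_vectors nr us) s0.
rewrite energy_vectors_cov -usE -/B.
(* The factor 2 cancels the one half in the real covariance. Real and imaginary parts give equal
   blocks, so the determinant is a square and its root is a determinant of the original size. *)
have -> : 1%:M + (2 * s) *: (block_mx B 0 0 B *m S) =
    block_mx (1%:M + s *: (B *m Psi)) 0 0 (1%:M + s *: (B *m Psi)).
  rewrite -scalemxAr scalerA (mulrAC 2) divff// mul1r mulmx_block.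
  rewrite !mulmx0 !mul0mx !addr0 !add0r scale_block_mx !scaler0.
  by rewrite scalar_mx_block add_block_mx !addr0.
rewrite det_ublock -expr2 sqrtr_sqr ger0_norm; last first.
  have [al /allP al0 [-> _]] := psd_mul_spectrum symmetric_psd_kron1 psdPsi.
  rewrite big_seq prodr_ge0// => x /al0 x0.
  by rewrite addr_ge0// mulr_ge0.
move=> <-; apply: eq_integral => x _; congr (expR _)%:E; congr (_ * _).
by rewrite /energy /received usE energy_sum_sqr.
Qed.

End laplace.

(** * Large deviations *)

Section cumulant.
Context (R : realType) (al : seq R).
Hypothesis al_ge0 : all (>= 0) al.

(** In the application, minus the logarithm of the Laplace transform of one energy. *)
Definition cumulant (s : R) : R := \sum_(x <- al) ln (1 + s * x).
(** The derivative of [cumulant]: the mean energy under the law reweighted by [exp(- s energy)]. *)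
Definition tilted_mean (s : R) : R := \sum_(x <- al) x / (1 + s * x).

Let al0 x : x \in al -> 0 <= x. Proof. by move/(allP al_ge0). Qed.

Let den_gt0 s x : 0 <= s -> x \in al -> 0 < 1 + s * x.
Proof. by move=> s0 xal; rewrite ltr_pwDl// mulr_ge0// al0. Qed.

Lemma expR_cumulant s : 0 <= s -> expR (cumulant s) = \prod_(x <- al) (1 + s * x).
Proof.
move=> s0; rewrite expR_sum big_seq [RHS]big_seq; apply: eq_bigr => x xal.
by rewrite lnK// posrE den_gt0.
Qed.

(** Concavity in tangent form, term by term from [ln (1 + y) <= y] with
    [y = (t - s) x / (1 + s x)]. *)
Lemma cumulant_le (s t : R) : 0 <= s -> 0 <= t ->
  cumulant t - cumulant s <= (t - s) * tilted_mean s.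
Proof.
move=> s0 t0; rewrite /cumulant /tilted_mean mulr_sumr -sumrB.
rewrite big_seq [leRHS]big_seq; apply: ler_sum => x xal.
have sx := den_gt0 s0 xal; have tx := den_gt0 t0 xal.
rewrite -ln_div ?posrE//.
rewrite (_ : (1 + t * x) / (1 + s * x) = 1 + (t - s) * (x / (1 + s * x))); last first.
  by field; rewrite gt_eqF.
apply: le_ln1Dx.
have : 0 < (1 + t * x) / (1 + s * x) by rewrite divr_gt0.
rewrite (_ : (1 + t * x) / (1 + s * x) = 1 + (t - s) * (x / (1 + s * x))).
  lra.
by field; rewrite gt_eqF.
Qed.

Lemma cumulant0 : cumulant 0 = 0.
Proof. by rewrite /cumulant big1// => x _; rewrite mul0r addr0 ln1. Qed.

Lemma tilted_mean0 : tilted_mean 0 = \sum_(x <- al) x.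
Proof. by apply: eq_bigr => x _; rewrite mul0r addr0 divr1. Qed.

Lemma tilted_mean_lip (s t : R) : 0 <= s -> s <= t ->
  tilted_mean s - tilted_mean t <= (t - s) * \sum_(x <- al) x ^+ 2.
Proof.
move=> s0 st; have t0 := le_trans s0 st.
rewrite /tilted_mean mulr_sumr -sumrB big_seq [leRHS]big_seq ler_sum// => x xal.
have sx := den_gt0 s0 xal; have tx := den_gt0 t0 xal.
rewrite (_ : _ - _ = (t - s) * x ^+ 2 / ((1 + s * x) * (1 + t * x))); last first.
  by field; rewrite !gt_eqF.
have h1 : 1 <= (1 + s * x) * (1 + t * x).
  by rewrite mulr_ege1// lerDl mulr_ge0// al0.
by rewrite ler_pdivrMr ?mulr_gt0// ler_peMr// mulr_ge0 ?sqr_ge0// subr_ge0.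
Qed.

Lemma tilted_mean_decreasing (s t : R) : 0 < \sum_(x <- al) x -> 0 <= s -> s < t ->
  tilted_mean t < tilted_mean s.
Proof.
move=> sum0 s0 st; have t0 := le_trans s0 (ltW st).
rewrite -subr_gt0 /tilted_mean -sumrB.
have dE x : x \in al -> x / (1 + s * x) - x / (1 + t * x) =
    (t - s) * x ^+ 2 / ((1 + s * x) * (1 + t * x)).
  by move=> xal; field; rewrite !gt_eqF ?den_gt0.
have d0 x : x \in al -> 0 <= x / (1 + s * x) - x / (1 + t * x).
  move=> xal; rewrite dE//; apply: divr_ge0.
    by rewrite mulr_ge0 ?sqr_ge0// subr_ge0 ltW.
  by rewrite ltW// mulr_gt0// den_gt0.
have [x xal x0] : exists2 x, x \in al & 0 < x.
  apply/hasP; rewrite -[has _ _]negbK -all_predC; apply/negP => /allP h.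
  move: sum0; rewrite big_seq big1 ?ltxx// => x xal.
  by apply/eqP; rewrite eq_le al0// andbT leNgt; exact: h.
rewrite (perm_big _ (perm_to_rem xal))/= big_cons ltr_pwDl//.
  by rewrite dE// divr_gt0 ?mulr_gt0 ?subr_gt0 ?exprn_gt0 ?den_gt0.
by rewrite big_seq sumr_ge0// => y /mem_rem/d0.
Qed.

Lemma tilted_mean_solve (a : R) : 0 < a -> a <= \sum_(x <- al) x ->
  exists2 s, 0 <= s & tilted_mean s = a.
Proof.
(* Each term of [tilted_mean b] is at most [1 / b], so this [b] brings the sum below [a] and the
   intermediate value theorem applies on [[0, b]]. *)
move=> a0 aal; pose b := ((size al)%:R + 1) / a.
have b0 : 0 < b by rewrite divr_gt0// ltr_wpDl.
have Gb : tilted_mean b <= a.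
  apply: (@le_trans _ _ (\sum_(x <- al) b^-1)).
    rewrite /tilted_mean big_seq [leRHS]big_seq ler_sum// => x xal.
    rewrite ler_pdivrMr ?den_gt0// ?(ltW b0)// mulrDr mulr1 mulKf ?gt_eqF//.
    by rewrite lerDr invr_ge0 ltW.
  rewrite big_const_seq count_predT iter_addr addr0 /b invf_div.
  by rewrite -[leLHS]mulr_natr mulrAC ler_pdivrMr ?ltr_wpDl// ler_pM2l// lerDl.
have cG : {within `[0, b], continuous tilted_mean}.
  apply: continuous_in_subspaceT => s; rewrite inE/= in_itv/= => /andP[s0 _].
  rewrite /tilted_mean; elim: al al_ge0 => [_|x t IH /= /andP[x0 t0]].
    by under eq_fun do rewrite big_nil; exact: cvg_cst.
  under eq_fun do rewrite big_cons.
  apply: cvgD; last exact: IH.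
  apply: cvgM; first exact: cvg_cst.
  apply: cvgV; first by rewrite gt_eqF// ltr_pwDl// mulr_ge0.
  apply: cvgD; first exact: cvg_cst.
  by apply: cvgM; [exact: cvg_id|exact: cvg_cst].
have [|s] := @IVT R tilted_mean 0 b a (ltW b0) cG.
  by rewrite tilted_mean0 ge_min Gb orbT le_max aal.
by rewrite in_itv/= => /andP[s0 _] <-; exists s.
Qed.

End cumulant.

(** * Deviations of the total energy below and above its mean *)

Section large_deviations.
Context (R : realType) (d : measure_display) (T : measurableType d).
Variables (P : probability T R) (S : nat -> T -> R) (al : seq R).
Hypothesis mS : forall K, measurable_fun setT (S K).
Hypothesis al_ge0 : all (>= 0) al.
Hypothesis laplaceS : forall K s, 0 <= s ->
  (\int[P]_x (expR (- s * S K x))%:E = (expR (- (K%:R * cumulant al s)))%:E)%E.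

Let L := cumulant al.

Let mexp K s : measurable_fun setT (fun x => expR (- s * S K x)).
Proof. by apply: measurableT_comp => //; exact: measurable_funM. Qed.

Lemma measurable_le_set (X : T -> R) (c : R) : measurable_fun setT X ->
  measurable [set x | X x <= c].
Proof.
move=> mX; have : measurable_fun setT (fun x => X x <= c).
  by apply: measurable_fun_ler => //; exact: measurable_cst.
by move=> /(_ measurableT [set true] I); rewrite setTI.
Qed.

Lemma measurable_ge_set (X : T -> R) (c : R) : measurable_fun setT X ->
  measurable [set x | c <= X x].
Proof.
move=> mX; have : measurable_fun setT (fun x => c <= X x).
  by apply: measurable_fun_ler => //; exact: measurable_cst.
by move=> /(_ measurableT [set true] I); rewrite setTI.
Qed.

Lemma integralZl_indic_prob (c : R) (A : set T) : 0 <= c -> measurable A ->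
  (\int[P]_x (c * \1_A x)%:E = c%:E * P A)%E.
Proof.
move=> c0 mA; under eq_integral do rewrite EFinM.
rewrite ge0_integralZl//=.
- by rewrite integral_indic//= setIT.
- by apply/measurable_EFinP; exact: measurable_indic.
Qed.

(* On b K <= S K <= a K the left side is at most exp(-s b K); the last two terms
   control the complement exactly as Markov's inequality would under the tilted
   law with density proportional to exp(-s (S K)). *)
Lemma tilting_bound K (a b s t u : R) : 0 <= t -> t <= s -> 0 <= u ->
  ((expR (- (K%:R * L s)))%:E <=
   (expR (- (s * (K%:R * b))))%:E * P [set x | S K x <= K%:R * a]%R +
   (expR (- (t * (K%:R * a)) - K%:R * L (s - t)))%:E +
   (expR (u * (K%:R * b) - K%:R * L (s + u)))%:E)%E.
Proof.
move=> t0 ts u0; have s0 := le_trans t0 ts.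
pose A := [set x | S K x <= K%:R * a]%R.
have mA : measurable A by exact: measurable_le_set.
rewrite -(laplaceS K s0).
pose f1 x := expR (- (s * (K%:R * b))) * \1_A x.
pose f2 x := expR (- (t * (K%:R * a))) * expR (- (s - t) * S K x).
pose f3 x := expR (u * (K%:R * b)) * expR (- (s + u) * S K x).
have mf1 : measurable_fun setT f1.
  by apply: measurable_funM => //; exact: measurable_indic.
have mf2 : measurable_fun setT f2 by apply: measurable_funM => //; exact: mexp.
have mf3 : measurable_fun setT f3 by apply: measurable_funM => //; exact: mexp.
have f10 x : 0 <= f1 x by rewrite mulr_ge0 ?expR_ge0.
have f20 x : 0 <= f2 x by rewrite mulr_ge0 ?expR_ge0.
have f30 x : 0 <= f3 x by rewrite mulr_ge0 ?expR_ge0.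
apply: (@le_trans _ _ (\int[P]_x ((f1 x)%:E + (f2 x)%:E + (f3 x)%:E))%E).
  apply: ge0_le_integral => //.
  - by apply/measurable_EFinP; exact: mexp.
  - by do !apply: emeasurable_funD; exact/measurable_EFinP.
  - move=> x _; rewrite -!EFinD lee_fin /f1 indicE.
    have [xA|xA] := boolP (x \in A); last first.
      have aS : K%:R * a < S K x.
        by rewrite ltNge; apply: contraNN xA => ?; rewrite inE.
      rewrite mulr0 add0r (le_trans _ (_ : f2 x <= _))// ?lerDl//.
      by rewrite /f2 -expRD ler_expR; nra.
    have [bS|Sb] := leP (K%:R * b) (S K x).
      rewrite mulr1 -addrA (@le_trans _ _ (expR (- (s * (K%:R * b)))))//.
        by rewrite ler_expR; nra.
      by rewrite lerDl addr_ge0.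
    rewrite (@le_trans _ _ (f3 x))//; last by rewrite lerDr addr_ge0// mulr_ge0// expR_ge0.
    by rewrite /f3 -expRD ler_expR; nra.
have mE (f : T -> R) : measurable_fun setT f -> measurable_fun setT (EFin \o f).
  by move=> mf; exact/measurable_EFinP.
have E0 (f : T -> R) : (forall x, 0 <= f x) -> forall x, setT x -> (0 <= (f x)%:E)%E.
  by move=> f0 x _; rewrite lee_fin.
rewrite (@ge0_integralD _ _ _ P setT measurableT (fun x => (f1 x)%:E + (f2 x)%:E)%E
  (EFin \o f3)); last 4 first.
- by move=> x _; rewrite adde_ge0 ?lee_fin.
- by apply: emeasurable_funD; exact: mE.
- exact: E0.
- exact: mE.
rewrite (@ge0_integralD _ _ _ P setT measurableT (EFin \o f1) (EFin \o f2));
  [|exact: E0|exact: mE|exact: E0|exact: mE].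
rewrite integralZl_indic_prob ?expR_ge0//.
have Zl (c r : R) : 0 <= c -> 0 <= r -> (\int[P]_x (c * expR (- r * S K x))%:E =
    (c * expR (- (K%:R * L r)))%:E)%E.
  move=> c0 r0; under eq_integral do rewrite EFinM.
  rewrite ge0_integralZl ?lee_fin//.
    by rewrite laplaceS.
  by apply/measurable_EFinP; exact: mexp.
by rewrite !Zl ?expR_ge0 ?subr_ge0 ?addr_ge0// -!expRD.
Qed.

(** The tilt is [s2 = s + 2 del], whose mean lies strictly between [b] and [a]. Moving it by [del]
    either way, to [s1] and [s3], gives exponential bounds for both tails. *)
Lemma lower_deviation (a s eps : R) : 0 < a -> a <= \sum_(x <- al) x ->
  0 <= s -> tilted_mean al s = a -> 0 < eps ->
  \forall K \near \oo,
    ((expR (- (K%:R * (L s - s * a + eps))))%:E <= P [set x | S K x <= K%:R * a]%R)%E.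
Proof.
move=> a0 aal s0 sa eps0.
have sum0 : 0 < \sum_(x <- al) x := lt_le_trans a0 aal.
set Q := \sum_(x <- al) x ^+ 2.
have Q0 : 0 <= Q by apply: sumr_ge0 => x _; exact: sqr_ge0.
(* The width of the window [[b, a]]; it costs [s2 * c] in the exponent, at most [eps / 2] as
   [s2 <= s + 1]. *)
pose c := eps / (2 * (s + 1)).
have c0 : 0 < c by rewrite divr_gt0// mulr_gt0// ltr_wpDl.
(* The first bound gives [s2 <= s + 1]; the second keeps the tilted mean above [b = a - c] as far as
   [s3 = s + 3 del]. *)
pose del := Num.min 2^-1 (c / (3 * (Q + 1))).
have del0 : 0 < del.
  by rewrite lt_min invr_gt0 ltr0n/= divr_gt0// mulr_gt0// ltr_wpDl.
have delQ : 3 * del * Q < c.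
  have : del <= c / (3 * (Q + 1)) by rewrite ge_min lexx orbT.
  by rewrite ler_pdivlMr ?mulr_gt0 ?ltr_wpDl//; nra.
have del2 : 2 * del <= 1.
  have : del <= 2^-1 by rewrite ge_min lexx.
  lra.
pose s1 := s + del; pose s2 := s + 2 * del; pose s3 := s + 3 * del; pose b := a - c.
have s1_ge0 : 0 <= s1 by rewrite /s1; lra.
have s2_ge0 : 0 <= s2 by rewrite /s2; lra.
have s3_ge0 : 0 <= s3 by rewrite /s3; lra.
have m1 : tilted_mean al s1 < a.
  by rewrite -sa; apply: tilted_mean_decreasing => //; rewrite /s1; lra.
have m3 : b < tilted_mean al s3.
  have := @tilted_mean_lip _ _ al_ge0 s s3 s0; rewrite sa -/Q => h.
  have : a - tilted_mean al s3 <= (s3 - s) * Q by apply: h; rewrite /s3; lra.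
  by rewrite /s3 /b; nra.
(* [e1] and [e2] are the rates at which the upper and lower tails become negligible against
   [exp(- K L(s2))]. *)
pose e1 := del * (a - tilted_mean al s1).
pose e2 := del * (tilted_mean al s3 - b).
have e10 : 0 < e1 by rewrite mulr_gt0// subr_gt0.
have e20 : 0 < e2 by rewrite mulr_gt0// subr_gt0.
have L1 : L s2 + e1 <= del * a + L (s2 - del).
  have -> : s2 - del = s1 by rewrite /s2 /s1; ring.
  have := cumulant_le al_ge0 s1_ge0 s2_ge0; rewrite -/L /e1.
  have -> : s2 - s1 = del by rewrite /s2 /s1; ring.
  nra.
have L2 : L s2 + e2 <= L (s2 + del) - del * b.
  have -> : s2 + del = s3 by rewrite /s2 /s3; ring.
  have := cumulant_le al_ge0 s3_ge0 s2_ge0; rewrite -/L /e2.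
  have -> : s2 - s3 = - del by rewrite /s2 /s3; ring.
  nra.
have L3 : L s2 - s2 * b <= L s - s * a + eps / 2.
  have := cumulant_le al_ge0 s0 s2_ge0; rewrite -/L sa.
  have : s2 * c <= eps / 2.
    have -> : eps / 2 = (s + 1) * c by rewrite /c; field; rewrite gt_eqF// ltr_wpDl.
    by rewrite ler_pM2r// /s2; lra.
  rewrite /b; nra.
pose e := Num.min e1 e2; have e0 : 0 < e by rewrite lt_min e10.
near=> K.
have K0 : 0 <= K%:R :> R by [].
(* Each tail will take at most a quarter of the left side; the factor 2 then lost is paid for by the
   remaining [eps / 2]. *)
have K4 : 4 <= expR (K%:R * e).
  rewrite (le_trans _ (expR_ge1Dx _))//.
  have : 3 / e <= K%:R by near: K; exact: nbhs_infty_ger.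
  by rewrite ler_pdivrMr//; lra.
have K2 : 2 <= expR (K%:R * (eps / 2)).
  rewrite (le_trans _ (expR_ge1Dx _))//.
  have : 1 / (eps / 2) <= K%:R by near: K; exact: nbhs_infty_ger.
  by rewrite ler_pdivrMr ?divr_gt0//; lra.
have := @tilting_bound K a b s2 del del (ltW del0) _ (ltW del0).
have -> : P [set x | S K x <= K%:R * a]%R = (fine (P [set x | S K x <= K%:R * a]%R))%:E.
  by rewrite fineK// fin_num_measure//; exact: measurable_le_set.
set p := fine _.
rewrite -EFinM -!EFinD !lee_fin => h.
have {}h : expR (- (K%:R * L s2)) <= expR (- (s2 * (K%:R * b))) * p +
   expR (- (del * (K%:R * a)) - K%:R * L (s2 - del)) +
   expR (del * (K%:R * b) - K%:R * L (s2 + del)).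
  by apply: h; rewrite /s2; lra.
have q1 : expR (- (del * (K%:R * a)) - K%:R * L (s2 - del)) <=
    expR (- (K%:R * L s2)) / 4.
  rewrite ler_pdivlMr//; apply: (@le_trans _ _ (expR (- (K%:R * (L s2 + e1))) * expR (K%:R * e))).
    by rewrite ler_pM ?expR_ge0// ler_expR; nra.
  rewrite -expRD ler_expR.
  have : e <= e1 by rewrite ge_min lexx.
  nra.
have q2 : expR (del * (K%:R * b) - K%:R * L (s2 + del)) <=
    expR (- (K%:R * L s2)) / 4.
  rewrite ler_pdivlMr//; apply: (@le_trans _ _ (expR (- (K%:R * (L s2 + e2))) * expR (K%:R * e))).
    by rewrite ler_pM ?expR_ge0// ler_expR; nra.
  rewrite -expRD ler_expR.
  have : e <= e2 by rewrite ge_min lexx orbT.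
  nra.
have {h q1 q2} h : expR (- (K%:R * L s2)) / 2 <= expR (- (s2 * (K%:R * b))) * p by lra.
have {}h : expR (- (K%:R * L s2)) * expR (s2 * (K%:R * b)) / 2 <= p.
  have e1p : expR (s2 * (K%:R * b)) * expR (- (s2 * (K%:R * b))) = 1.
    by rewrite -expRD subrr expR0.
  have := ler_wpM2l (expR_ge0 (s2 * (K%:R * b))) h.
  rewrite (mulrA _ _ p) e1p mul1r; apply: le_trans.
  by rewrite [leRHS]mulrCA [leRHS]mulrA.
apply: le_trans h; rewrite -expRD ler_pdivlMr//.
apply: (@le_trans _ _ (expR (- (K%:R * (L s - s * a + eps))) * expR (K%:R * (eps / 2)))).
  by rewrite ler_wpM2l ?expR_ge0.
by rewrite -expRD ler_expR; nra.
Unshelve. all: end_near. Qed.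

Lemma le_cumulant_sum s : 0 <= s -> L s <= s * \sum_(x <- al) x.
Proof.
move=> s0; have := cumulant_le al_ge0 (lexx 0) s0.
by rewrite cumulant0 tilted_mean0 !subr0.
Qed.

(** The tangent at [s] evaluated at 0, with the slope bounded below by the Lipschitz estimate. *)
Lemma ge_cumulant_sum s : 0 <= s ->
  s * \sum_(x <- al) x - s ^+ 2 * \sum_(x <- al) x ^+ 2 <= L s.
Proof.
move=> s0; have := cumulant_le al_ge0 s0 (lexx 0).
have := tilted_mean_lip al_ge0 (lexx 0) s0.
rewrite tilted_mean0 cumulant0 -/L !sub0r !subr0; nra.
Qed.

(* Second moment method for Z = exp(-S K / K), whose first two moments tend to
   those of the constant exp(-mean). *)
Lemma upper_tail_cvg0 (eps : R) : 0 < eps ->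
  P [set x | K%:R * (\sum_(x <- al) x + eps) <= S K x]%R @[K --> \oo] --> 0%E.
Proof.
move=> eps0; set m := \sum_(x <- al) x; set Q := \sum_(x <- al) x ^+ 2.
have Q0 : 0 <= Q by apply: sumr_ge0 => x _; exact: sqr_ge0.
pose c := expR (- m); pose del := c - expR (- (m + eps)).
have c0 : 0 < c by exact: expR_gt0.
have del0 : 0 < del by rewrite subr_gt0 ltr_expR; lra.
(* Obtained from [E Z >= c] and [E Z^2 <= c^2 exp(4 Q / K)], since [Z] is at distance at least [del]
   from [c] on the event. *)
pose bd K : R := (c ^+ 2 / del ^+ 2) * (expR (4 * Q / K%:R) - 1).
have bd0 : (bd K)%:E @[K --> \oo] --> 0%E.
  apply: cvg_EFin; first exact: nearW.
  have h4 : 4 * Q / K%:R @[K --> \oo] --> (0 : R).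
    rewrite -[X in _ --> X](mulr0 (4 * Q)); apply: cvgM; first exact: cvg_cst.
    by rewrite -cvg_shiftS; exact: cvg_harmonic.
  have := cvg_comp _ _ h4 (@continuous_expR R 0); rewrite expR0 => h1.
  rewrite -(mulr0 (c ^+ 2 / del ^+ 2)); apply: cvgM; first exact: cvg_cst.
  by rewrite -[X in _ --> X](subrr (1 : R)); apply: cvgB h1 (cvg_cst _).
apply: (squeeze_cvge _ (cvg_cst 0%E) bd0).
exists 1%N => // K /= K1; have K0 : 0 < K%:R :> R by rewrite ltr0n.
rewrite measure_ge0/=.
pose A := [set x | K%:R * (m + eps) <= S K x]%R.
have mA : measurable A by exact: measurable_ge_set.
pose Z r x := expR (- (r / K%:R) * S K x).
have mZ r : measurable_fun setT (Z r) by exact: mexp.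
have ZE r : 0 <= r -> (\int[P]_x (Z r x)%:E = (expR (- (K%:R * L (r / K%:R))))%:E)%E.
  by move=> r0; rewrite laplaceS// divr_ge0// ltW.
(* This is [del^2 1_A <= (Z - c)^2], with the cross term moved to the left so that both integrands
   are nonnegative. *)
have key : (\int[P]_x (del ^+ 2 * \1_A x + 2 * c * Z 1 x)%:E <=
    \int[P]_x (Z 2 x + c ^+ 2 * \1_setT x)%:E)%E.
  have mI B : measurable B -> measurable_fun setT (\1_B : T -> R).
    exact: measurable_indic.
  apply: ge0_le_integral => //.
  - by move=> x _; rewrite lee_fin addr_ge0// !mulr_ge0 ?sqr_ge0 ?expR_ge0// ltW.
  - apply/measurable_EFinP; apply: measurable_funD.
      by apply: measurable_funM => //; exact: mI.
    exact: measurable_funM.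
  - apply/measurable_EFinP; apply: measurable_funD => //.
    by apply: measurable_funM => //; exact: mI.
  - move=> x _; rewrite lee_fin indicT mulr1.
    have -> : Z 2 x = Z 1 x ^+ 2.
      by rewrite /Z expr2 -expRD; congr expR; field; rewrite gt_eqF.
    rewrite indicE; have [xA|_] := boolP (x \in A); last first.
      by rewrite mulr0 add0r; have := sqr_ge0 (Z 1 x - c); nra.
    move: xA; rewrite inE /A/= => xA.
    have Zc : Z 1 x <= c - del.
      rewrite /del opprB addrC subrK ler_expR mulNr lerN2 mul1r mulrC.
      by rewrite ler_pdivlMr// mulrC.
    rewrite mulr1; nra.
move: key.
have i1 : (\int[P]_x (del ^+ 2 * \1_A x + 2 * c * Z 1 x)%:E =
    (del ^+ 2)%:E * P A + (2 * c * expR (- (K%:R * L (1 / K%:R))))%:E)%E.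
  under eq_integral do rewrite EFinD.
  rewrite ge0_integralD//=; last 4 first.
  - by move=> x _; rewrite lee_fin mulr_ge0// sqr_ge0.
  - apply/measurable_EFinP; apply: measurable_funM => //; exact: measurable_indic.
  - by move=> x _; rewrite lee_fin !mulr_ge0 ?expR_ge0// ltW.
  - by apply/measurable_EFinP; exact: measurable_funM.
  rewrite integralZl_indic_prob ?sqr_ge0//; congr (_ + _)%E.
  under eq_integral do rewrite EFinM.
  rewrite ge0_integralZl//=; last 3 first.
  - exact/measurable_EFinP.
  - by move=> x _; rewrite lee_fin expR_ge0.
  - by rewrite lee_fin mulr_ge0// ltW.
  by rewrite ZE.
have i2 : (\int[P]_x (Z 2 x + c ^+ 2 * \1_setT x)%:E =
    (expR (- (K%:R * L (2 / K%:R))) + c ^+ 2)%:E)%E.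
  under eq_integral do rewrite EFinD.
  rewrite ge0_integralD//=; last 4 first.
  - by move=> x _; rewrite lee_fin expR_ge0.
  - exact/measurable_EFinP.
  - by move=> x _; rewrite lee_fin mulr_ge0// sqr_ge0.
  - apply/measurable_EFinP; apply: measurable_funM => //; exact: measurable_indic.
  by rewrite ZE// integralZl_indic_prob ?sqr_ge0// probability_setT mule1.
rewrite i1 i2 -/A.
have -> : P A = (fine (P A))%:E by rewrite fineK// fin_num_measure.
rewrite -EFinM -EFinD !lee_fin => h.
rewrite /bd mulrAC ler_pdivlMr ?exprn_gt0//.
have e1 : c <= expR (- (K%:R * L (1 / K%:R))).
  rewrite ler_expR lerN2.
  have h1 : L (1 / K%:R) <= m / K%:R.
    rewrite (_ : m / K%:R = 1 / K%:R * m); last by rewrite mulrAC mul1r.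
    by apply: le_cumulant_sum; rewrite divr_ge0// ltW.
  by move: h1; rewrite ler_pdivlMr// mulrC.
have e2 : expR (- (K%:R * L (2 / K%:R))) <= c ^+ 2 * expR (4 * Q / K%:R).
  rewrite /c expr2 -!expRD ler_expR.
  have K2 : 0 <= 2 / K%:R :> R by rewrite divr_ge0// ltW.
  have := ge_cumulant_sum K2.
  rewrite -(ler_pM2l K0) -/m -/Q => h2.
  have : K%:R * (2 / K%:R * m - (2 / K%:R) ^+ 2 * Q) = 2 * m - 4 * Q / K%:R.
    by field; rewrite gt_eqF.
  lra.
have := ler_wpM2l (ltW c0) e1; rewrite -expr2.
lra.
Qed.

End large_deviations.

(** * Energy per nat and outage exponent *)

Section wideband.
Context (R : realType) (d : measure_display) (T : measurableType d).
Variables (P : probability T R) (nr nt : nat) (H : nat -> T -> 'M[R[i]]_(nr, nt)).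
Variables (Sigma : 'M[R]_nt) (rho : R) (al : seq R).
Hypotheses (psdSigma : symmetric_psd Sigma) (rho_gt0 : 0 < rho) (iidH : iid P H).
Hypothesis al_ge0 : all (>= 0) al.
Hypothesis laplaceH : forall s, 0 <= s ->
  (\int[P]_x (expR (- s * energy Sigma (H 0%N x)))%:E = (expR (- cumulant al s))%:E)%E.

Let L := cumulant al.
Let m := \sum_(x <- al) x.
Let S K w := \sum_(k < K) energy Sigma (H k w).

Let menergy k : measurable_fun setT (fun w => energy Sigma (H k w)).
Proof.
exact: (measurableT_comp (@measurable_energy R nr nt Sigma) (measurable_iid iidH k)).
Qed.

Let mS K : measurable_fun setT (S K).
Proof. by apply: measurable_sum => k. Qed.

Lemma laplace_total_energy K s : 0 <= s ->
  (\int[P]_x (expR (- s * S K x))%:E = (expR (- (K%:R * L s)))%:E)%E.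
Proof.
move=> s0; rewrite -mulrN expRM_natl.
rewrite -(@integral_iid_prod _ _ _ P _ _ H iidH K (fun h => expR (- s * energy Sigma h)))//.
- apply: eq_integral => x _; congr EFin.
  by rewrite /S mulr_sumr expR_sum.
- apply: measurableT_comp => //; apply: measurable_funM => //.
  exact: measurable_energy.
- exact: (laplaceH s0).
Qed.

Lemma rateE K w : rate H Sigma rho K w = \sum_(k < K) ln (gain Sigma (rho / K%:R) (H k w)).
Proof. by []. Qed.

Let coef_ge0 K : 0 <= rho / K%:R.
Proof. by rewrite divr_ge0// ltW. Qed.

Let mlngain K : measurable_fun setT
  (fun h : cmx_space R nr nt => ln (gain Sigma (rho / K%:R) h)).
Proof.
apply: (measurableT_comp (@measurable_ln R)).
exact: (@measurable_gain R nr nt Sigma (rho / K%:R)).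
Qed.

Lemma measurable_rate K : measurable_fun setT (rate H Sigma rho K).
Proof.
rewrite (_ : rate _ _ _ _ = fun w => \sum_(k < K) ln (gain Sigma (rho / K%:R) (H k w)))//.
apply: measurable_sum => k.
exact: (measurableT_comp (mlngain K) (measurable_iid iidH k)).
Qed.

Lemma rate_ge0 K w : 0 <= rate H Sigma rho K w.
Proof.
by rewrite rateE sumr_ge0// => k _; rewrite ln_ge0// gain_ge1.
Qed.

Lemma rate_le K w : rate H Sigma rho K w <= rho / K%:R * S K w.
Proof.
by rewrite rateE /S mulr_sumr ler_sum// => k _; exact: ln_gain_le.
Qed.

Lemma chernoff_factor_cvg s : 0 <= s ->
  (\int[P]_x (expR (- (s * K%:R / rho) * ln (gain Sigma (rho / K%:R) (H 0%N x))))%:E)%E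
    @[K --> \oo] --> (expR (- L s))%:E.
Proof.
move=> s0; rewrite -(laplaceH s0).
have mH0 := measurable_iid iidH 0.
pose f (K : nat) x : \bar R :=
  (expR (- (s * K%:R / rho) * ln (gain Sigma (rho / K%:R) (H 0%N x))))%:E.
have [] // := @dominated_convergence _ _ R P setT measurableT f
  (fun x => (expR (- s * energy Sigma (H 0%N x)))%:E) (cst 1%E).
- move=> K; apply/measurable_EFinP; apply: measurableT_comp => //.
  apply: measurable_funM => //.
  exact: (measurableT_comp (mlngain K) mH0).
- by apply/measurable_EFinP; apply: measurableT_comp => //; exact: measurable_funM.
- apply: aeW => x _; apply: cvg_EFin; first exact: nearW.
  have h : - (s * K%:R / rho) * ln (gain Sigma (rho / K%:R) (H 0%N x)) @[K --> \oo] -->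
      - s * energy Sigma (H 0%N x).
    rewrite (_ : - s * energy _ _ = (- s / rho) * (rho * energy Sigma (H 0%N x))); last first.
      by field; rewrite gt_eqF.
    rewrite (_ : (fun K : nat => _) = (fun K : nat =>
      (- s / rho) * (K%:R * ln (gain Sigma (rho / K%:R) (H 0%N x))))).
      by apply: cvgM; [exact: cvg_cst|exact: ln_gain_cvg].
    by apply/funext => K; field; rewrite gt_eqF.
  exact: (cvg_comp _ _ h (@continuous_expR R _)).
- exact: finite_measure_integrable_cst.
- apply: aeW => x K _; rewrite /f /= lee_fin ger0_norm ?expR_ge0//.
  rewrite -[leRHS]expR0 ler_expR mulNr oppr_le0; apply: mulr_ge0.
    by rewrite divr_ge0 ?mulr_ge0// ltW.
  exact: (ln_ge0 (gain_ge1 psdSigma _ (coef_ge0 K))).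
Qed.

(** The Chernoff parameter [s K / rho] turns the threshold [rho * a] into the exponent [K s a]. The
    law of one summand of the rate changes with K, so its factor is only eventually below
    [exp(- L(s) + eps)]; the K-th power costs [exp(K eps)]. *)
Lemma rate_chernoff (a s eps : R) : 0 <= s -> 0 < eps ->
  \forall K \near \oo, (P [set w | rate H Sigma rho K w <= rho * a]%R <=
     (expR (- (K%:R * (L s - s * a - eps))))%:E)%E.
Proof.
move=> s0 eps0.
have /fine_cvgP[fin cv] := chernoff_factor_cvg s0.
have Leps : expR (- L s) < expR (- L s + eps) by rewrite ltr_expR ltrDl.
have cv' := cvgr_le _ cv _ Leps.
near=> K.
have K0 : 0 < K%:R :> R by rewrite ltr0n; near: K; exists 1%N.
pose v := fine (\int[P]_x (expR (- (s * K%:R / rho) *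
  ln (gain Sigma (rho / K%:R) (H 0%N x))))%:E)%E.
have vE : (\int[P]_x (expR (- (s * K%:R / rho) *
  ln (gain Sigma (rho / K%:R) (H 0%N x))))%:E = v%:E)%E.
  by rewrite /v fineK//; near: K.
have vle : v <= expR (- L s + eps) by rewrite /v; near: K; exact: cv'.
have v0 : 0 <= v by rewrite fine_ge0// integral_ge0// => x _; rewrite lee_fin expR_ge0.
pose r := s * K%:R / rho.
have rE : (\int[P]_x (expR (- r * rate H Sigma rho K x))%:E = (v ^+ K)%:E)%E.
  rewrite -(@integral_iid_prod _ _ _ P _ _ H iidH K
    (fun h => expR (- r * ln (gain Sigma (rho / K%:R) h))) v)//.
  - apply: eq_integral => x _; congr EFin.
    by rewrite rateE mulr_sumr expR_sum.
  - by apply: measurableT_comp => //; apply: measurable_funM.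
pose A := [set w | rate H Sigma rho K w <= rho * a]%R.
have mA : measurable A by apply: measurable_le_set; exact: measurable_rate.
have : (\int[P]_x (expR (- (r * (rho * a))) * \1_A x)%:E <=
        \int[P]_x (expR (- r * rate H Sigma rho K x))%:E)%E.
  apply: ge0_le_integral => //.
  - by apply/measurable_EFinP; apply: measurable_funM => //; exact: measurable_indic.
  - apply/measurable_EFinP; apply: measurableT_comp => //; apply: measurable_funM => //.
    exact: measurable_rate.
  - move=> x _; rewrite lee_fin indicE.
    have [xA|_] := boolP (x \in A); last by rewrite mulr0 expR_ge0.
    move: xA; rewrite inE /A/= mulr1 ler_expR mulNr lerN2 => xA.
    by rewrite ler_wpM2l// divr_ge0 ?mulr_ge0// ltW.
rewrite rE integralZl_indic_prob ?expR_ge0// -/A.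
have -> : P A = (fine (P A))%:E by rewrite fineK// fin_num_measure.
rewrite -EFinM !lee_fin => h.
have rrho : r * (rho * a) = K%:R * (s * a) by rewrite /r; field; rewrite gt_eqF.
have h2 : v ^+ K <= expR (K%:R * (- L s + eps)).
  by rewrite expRM_natl lerXn2r// nnegrE expR_ge0.
have := ler_wpM2l (expR_ge0 (r * (rho * a))) (le_trans h h2).
rewrite mulrA -expRD subrr expR0 mul1r => /le_trans; apply.
by rewrite -expRD ler_expR rrho; nra.
Unshelve. all: end_near. Qed.

Lemma outage_exponent_cvg (eta s : R) : 0 < eta -> eta^-1 <= m ->
  0 <= s -> tilted_mean al s = eta^-1 ->
  wideband_outage_exponent P H Sigma rho eta (L s - s / eta)%:E.
Proof.
move=> eta0 etam s0 sa; rewrite /wideband_outage_exponent.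
set F := L s - s / eta.
have a0 : 0 < eta^-1 by rewrite invr_gt0.
pose A K := [set w | (rate H Sigma rho K w <= rho / eta)%R].
have mA K : measurable (A K) by apply: measurable_le_set; exact: measurable_rate.
pose p K := fine (P (A K)).
have pE K : P (A K) = (p K)%:E by rewrite /p fineK// fin_num_measure.
have low eps : 0 < eps -> \forall K \near \oo, expR (- (K%:R * (F + eps))) <= p K.
  move=> eps0; near=> K.
  have K0 : 0 < K%:R :> R by rewrite ltr0n; near: K; exists 1%N.
  rewrite -lee_fin -pE.
  (* Since the rate is at most [(rho / K) S K], a small total energy already causes an outage. *)
  apply: (@le_trans _ _ (P [set x | S K x <= K%:R * eta^-1]%R)).
    near: K.
    by apply: (lower_deviation mS al_ge0 laplace_total_energy a0 etam s0 sa eps0).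
  apply: le_measure; rewrite ?inE//; first exact: measurable_le_set.
  move=> w /= Sw; apply: le_trans (rate_le K w) _.
  have := ler_wpM2l (coef_ge0 K) Sw.
  by rewrite mulrA divfK// gt_eqF.
have upp eps : 0 < eps -> \forall K \near \oo, p K <= expR (- (K%:R * (F - eps))).
  move=> eps0; have := rate_chernoff eta^-1 s0 eps0.
  by apply: filterS => K; rewrite -/(A K) pE lee_fin.
(* The extended logarithm and inverse are real only for positive arguments; both hold for large K,
   the probability being positive by [low]. *)
apply: (@cvg_trans _ ((- ln (p K) / K%:R)%:E @[K --> \oo])).
  apply: near_eq_cvg; near=> K.
  have K0 : 0 < K%:R :> R by rewrite ltr0n; near: K; exists 1%N.
  have p0 : 0 < p K.
    have l1 : expR (- (K%:R * (F + 1))) <= p K by near: K; exact: low.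
    exact: lt_le_trans (expR_gt0 _) l1.
  by rewrite -/(A K) pE lne_EFin// inver gt_eqF.
apply: cvg_EFin; first exact: nearW.
apply/cvgrPdist_le => eps eps0; near=> K.
have K0 : 0 < K%:R :> R by rewrite ltr0n; near: K; exists 1%N.
have l1 : expR (- (K%:R * (F + eps))) <= p K by near: K; exact: low.
have u1 : p K <= expR (- (K%:R * (F - eps))) by near: K; exact: upp.
have p0 : 0 < p K by apply: lt_le_trans (expR_gt0 _) l1.
have l2 : - (K%:R * (F + eps)) <= ln (p K).
  by rewrite -[leLHS]expRK ler_ln// posrE expR_gt0.
have u2 : ln (p K) <= - (K%:R * (F - eps)).
  by rewrite -[leRHS]expRK ler_ln// posrE expR_gt0.
rewrite /= ler_distl; apply/andP; split.
  by rewrite lerBlDr ler_pdivrMr//; lra.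
by rewrite -lerBlDr ler_pdivlMr//; lra.
Unshelve. all: end_near. Qed.

Lemma energy_per_nat_cvg :
  wideband_min_energy_per_nat P H Sigma rho ((m%:E)^-1)%E.
Proof.
have m0 : 0 <= m by rewrite /m big_seq sumr_ge0// => x /(allP al_ge0).
move=> U [oU Ul].
pose V := [set y : R | U y%:E].
have oV y : V y -> nbhs y V.
  by move=> Vy; have : nbhs y%:E U by exact: open_nbhs_nbhs.
(* The preimage of [U] under [x -> rho / x] away from 0 is open; the point 0, sent to [+oo], is
   treated apart. *)
pose W := [set x : R | x != 0 /\ V (rho / x)].
have nW x : W x -> nbhs x W.
  move=> [x0 Vx].
  have cx : rho / y @[y --> x] --> rho / x.
    by apply: cvgM; [exact: cvg_cst|exact: cvgV].
  have h1 : \forall y \near x, V (rho / y) by apply: cx; exact: oV.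
  have h2 : \forall y \near x, y != 0.
    exact: (cvgr_neq0 x (@cvg_id _ (nbhs x)) x0).
  by apply: filterS2 h2 h1 => y.
have mW : measurable W.
  by apply: open_measurable; rewrite openE => x /nW; rewrite /interior.
have UE x : U (rho%:E / x%:E)%E <-> W x \/ (x = 0 /\ U +oo%E).
  rewrite inver; have [->|x0] := eqVneq x 0.
    rewrite gt0_muley ?lte_fin//; split=> [Uy|[[/=]|[]//]]; first by right.
    by rewrite eqxx.
  rewrite -EFinM; split=> [Vx|[[]//|[/eqP]]]; first by left.
  by rewrite (negPf x0).
pose N K := [set w | ~ U (rho%:E / (rate H Sigma rho K w)%:E)%E].
have mN K : measurable (N K).
  have -> : N K = ~` (rate H Sigma rho K @^-1` [set x | U (rho%:E / x%:E)%E]) by [].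
  apply: measurableC; rewrite -[X in measurable X]setTI.
  apply: measurable_rate => //.
  have -> : [set x : R | U (rho%:E / x%:E)%E] = W `|` ([set 0] `&` [set _ | U +oo%E]).
    by apply/seteqP; split=> x /=; rewrite UE.
  apply: measurableU => //; apply: measurableI => //.
  have [Uy|nUy] := pselect (U +oo%E).
    by rewrite (_ : [set _ | _] = setT)//; apply/seteqP; split.
  by rewrite (_ : [set _ | _] = set0)//; apply/seteqP; split.
(* The lower bound on x is required only when [m > 0]: for [m = 0] the target is [+oo], and every
   small enough nonnegative rate, zero included, lands in [U]. *)
have [del del0 hdel] : exists2 del, 0 < del & forall x, 0 <= x -> x < rho * (m + del) ->
    (0 < m -> rho * (m - del) < x) -> U (rho%:E / x%:E)%E.
  have [m_eq0|m_neq0] := eqVneq m 0.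
    have Uy : nbhs +oo%E U.
      by apply: open_nbhs_nbhs; split=> //; move: Ul; rewrite m_eq0 inve0.
    have [M [_ hM]] := Uy.
    exists (`|M| + 1)^-1; first by rewrite invr_gt0 ltr_wpDl.
    rewrite m_eq0 add0r => x x0 xlt _.
    have [->|xn0] := eqVneq x 0.
      by rewrite inve0 gt0_muley ?lte_fin//; apply: hM; exact: ltry.
    have xp : 0 < x by rewrite lt_neqAle eq_sym xn0.
    rewrite inver (negPf xn0) -EFinM; apply: hM; rewrite lte_fin.
    have M1 : 0 < `|M| + 1 by rewrite ltr_wpDl.
    rewrite ltr_pdivlMr//; move: xlt; rewrite ltr_pdivlMr// => xlt.
    have := ler_norm M; nra.
  have mp : 0 < m by rewrite lt_neqAle eq_sym m_neq0.
  have Wm : W (rho * m).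
    split; first by rewrite mulf_neq0// gt_eqF.
    by move: Ul; rewrite inver (negPf m_neq0) /V/= invfM mulrA divff ?mul1r// gt_eqF.
  have /nbhs_ballP[e /= e0 be] := nW _ Wm.
  exists (e / rho); first by rewrite divr_gt0.
  move=> x x0 xlt /(_ mp) xgt; apply/UE; left; apply: be.
  rewrite /ball/= ltr_distl.
  have re : rho * (e / rho) = e by field; rewrite gt_eqF.
  by move: xlt xgt; rewrite mulrDr mulrBr re; lra.
(* Outside [A1] the rate is below [rho (m + del)] because the energy dominates it; outside [A2] it
   exceeds [rho (m - del)]. *)
pose A1 K := [set w | K%:R * (m + del) <= S K w]%R.
pose A2 K := [set w | rate H Sigma rho K w <= rho * (m - del)]%R.
have mA1 K : measurable (A1 K) by exact: measurable_ge_set.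
have mA2 K : measurable (A2 K) by apply: measurable_le_set; exact: measurable_rate.
have c1 : P (A1 K) @[K --> \oo] --> 0%E.
  exact: (upper_tail_cvg0 mS al_ge0 laplace_total_energy del0).
pose Q := \sum_(x <- al) x ^+ 2.
have Q0 : 0 <= Q by apply: sumr_ge0 => x _; exact: sqr_ge0.
(* Small enough for [s^2 Q] to take at most half of [s del]; what remains is at least [2 e], and [e]
   of it is spent in [rate_chernoff]. *)
pose s := del / (2 * (Q + 1)).
have s0 : 0 < s by rewrite divr_gt0// mulr_gt0// ltr_wpDl.
have sQ : s * Q <= del / 2.
  have : s * (Q + 1) = del / 2.
    by rewrite /s; field; rewrite gt_eqF// ltr_wpDl.
  have := ltW s0; nra.
pose e := s * del / 4.
have e0 : 0 < e by rewrite divr_gt0// mulr_gt0.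
have Le : e <= L s - s * (m - del) - e.
  have := ge_cumulant_sum al_ge0 (ltW s0); rewrite -/L -/m -/Q.
  have : s ^+ 2 * Q <= s * (del / 2) by rewrite expr2 -mulrA ler_pM2l.
  rewrite /e; lra.
have c2 : (expR (- (K%:R * e)))%:E @[K --> \oo] --> 0%E.
  apply: cvg_EFin; first exact: nearW.
  apply: (@cvg_trans _ ((expR (- e)) ^+ K @[K --> \oo])).
    by apply: near_eq_cvg; apply: nearW => K; rewrite /= -(mulrN K%:R e) expRM_natl.
  by apply: cvg_expr; rewrite ger0_norm ?expR_ge0// -[ltRHS]expR0 ltr_expR oppr_lt0.
have c12 : (P (A1 K) + (expR (- (K%:R * e)))%:E)%E @[K --> \oo] --> 0%E.
  by rewrite -[X in _ --> X](adde0 0%E); apply: cvgeD.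
apply: (squeeze_cvge _ (cvg_cst 0%E) c12).
have := rate_chernoff (m - del) (ltW s0) e0.
apply: filterS2 (nbhs_infty_gt 0) => K K1 ch.
have K0 : 0 < K%:R :> R by rewrite ltr0n.
rewrite measure_ge0/= -/(N K).
apply: (@le_trans _ _ (P (A1 K `|` A2 K))).
  apply: le_measure; rewrite ?inE//; first exact: measurableU.
  move=> w /= Nw; have [h1|h1] := leP (K%:R * (m + del)) (S K w); first by left.
  right; rewrite /A2/= leNgt; apply/negP => h2; apply: Nw.
  apply: hdel => //; first exact: rate_ge0.
  apply: le_lt_trans (rate_le K w) _.
  rewrite mulrAC ltr_pdivrMr// -mulrA ltr_pM2l// mulrC.
  by rewrite mulrC [ltRHS]mulrC.
apply: le_trans (measureU2 _ (mA1 K) (mA2 K)) _; rewrite leeD2l//.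
apply: le_trans ch _; rewrite lee_fin ler_expR lerN2.
by rewrite ler_pM2l.
Qed.

End wideband.

Theorem proposition2 (R : realType) (d : measure_display)
  (T : measurableType d) (P : probability T R)
  (nr nt : nat) (nr_gt0 : (0 < nr)%N) (nt_gt0 : (0 < nt)%N)
  (Sigma : 'M[R]_nt) (Psi : 'M[R]_(nr * nt))
  (H : nat -> T -> 'M[R[i]]_(nr, nt)) (rho : R) :
  symmetric_psd Sigma -> \tr Sigma = 1 ->
  symmetric_psd Psi ->
  0 < rho ->
  iid P H ->
  (forall k : nat,
     complex_normal P (fun w => vec (adjointmx (H k w))) (complexify Psi)) ->
  let A : 'M[R]_(nr * nt) := tensmx (1%:M : 'M[R]_nr) Sigma *m Psi in
  let etabar : \bar R := ((\tr A)%:E^-1)%E in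
  wideband_min_energy_per_nat P H Sigma rho etabar /\
  forall eta : R, 0 < eta -> (etabar <= eta%:E)%E ->
    wideband_outage_exponent P H Sigma rho eta
      (ereal_sup [set (lambda / eta + ln (\det (1%:M - lambda *: A)))%:E |
                    lambda in [set l : R | l <= 0]]).
Proof.
move=> psdSigma _ psdPsi rho0 iidH gaussH A.
have [al al0 [dE tE]] := psd_mul_spectrum (symmetric_psd_kron1 nr psdSigma) psdPsi.
have lap s : 0 <= s -> (\int[P]_x (expR (- s * energy Sigma (H 0%N x)))%:E =
    (expR (- cumulant al s))%:E)%E.
  move=> s0; rewrite (integral_expR_energy psdSigma psdPsi (gaussH 0%N) s0) dE.
  by rewrite expRN expR_cumulant.
rewrite /= /A tE; split; first exact: energy_per_nat_cvg.
move=> eta eta0 etale.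
have sum0 : 0 <= \sum_(x <- al) x by rewrite big_seq sumr_ge0// => x /(allP al0).
have etam : eta^-1 <= \sum_(x <- al) x.
  (* A zero trace makes [etabar] infinite, which no real [eta] can dominate. *)
  move: etale; rewrite inver; case: eqVneq => [_|sn0]; first by rewrite leye_eq.
  have sp : 0 < \sum_(x <- al) x by rewrite lt_neqAle eq_sym sn0.
  by rewrite lee_fin invf_ple// posrE.
have eta'0 : 0 < eta^-1 by rewrite invr_gt0.
have [s s0 sa] := tilted_mean_solve al0 eta'0 etam.
have detE l : l <= 0 -> ln (\det (1%:M - l *: (tensmx (1%:M : 'M[R]_nr) Sigma *m Psi))) =
    cumulant al (- l).
  by move=> l0; rewrite -scaleNr dE -expR_cumulant ?oppr_ge0// expRK.
(* The tangent inequality at [s], where the slope is [1 / eta], shows that [lambda = - s] attains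
   the supremum. *)
rewrite (_ : ereal_sup _ = (cumulant al s - s / eta)%:E).
  exact: outage_exponent_cvg.
apply/eqP; rewrite eq_le; apply/andP; split.
  apply: ge_ereal_sup => _ [l /= l0 <-]; rewrite lee_fin detE//.
  have l0' : 0 <= - l by rewrite oppr_ge0.
  have := cumulant_le al0 s0 l0'; rewrite sa; lra.
apply: ereal_sup_ubound; exists (- s); first by rewrite /= oppr_le0.
by rewrite detE ?oppr_le0// opprK mulNr addrC.
Qed.
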